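(* Let $G$ be a graph with vertex set $\{1,\ldots,r\}$. Then $\overline{\mathrm{astab}}(I(G))\leqslant \phi_0(G)$.
   Context: Graphs are finite and simple. $K$ is a field and $R=K[x_1,\ldots,x_r]$. The edge ideal of $G$ is $I(G)=(x_ix_j\mid \{i,j\}\in E(G))\subseteq R$. The integral closure $\overline{J}$ of an ideal $J$ of $R$ is the ideal of all $x\in R$ satisfying an equation $x^n+a_1x^{n-1}+\cdots+a_n=0$ with $n\geqslant 1$ and $a_i\in J^i$ for all $i$. For an ideal $I$ of $R$, $$\overline{\mathrm{astab}}(I)=\min\{n_0\geqslant 1\mid \mathrm{Ass}(R/\overline{I^n})=\mathrm{Ass}(R/\overline{I^{n_0}})\text{ for all } n\geqslant n_0\}.$$ A leaf is a vertex of degree one and a leaf edge is an edge incident with a leaf; $\upsilon(G)$ and $\varepsilon_0(G)$ denote the numbers of vertices and of leaf edges of $G$. Definition of $n_0(G)$ and $\phi_0(G)$: let $G_1,\ldots,G_s$ be all the connected nonbipartite components of $G$, let $2k_i-1$ be the minimum length of odd cycles of $G_i$ for $i=1,\ldots,s$, and let $2k-1$ be the minimum length of odd cycles of $G$. Define $$n_0(G)=\begin{cases}1 & \text{if } s=0,\\ \sum_{i=1}^s(\upsilon(G_i)-\varepsilon_0(G_i)-k_i)+j+k & \text{if } s=2j \text{ for } j\geqslant 1,\\ \sum_{i=1}^s(\upsilon(G_i)-\varepsilon_0(G_i)-k_i)+j+1 & \text{if } s=2j+1 \text{ for } j\geqslant 0,\end{cases}$$ and $\phi_0(G)=\max\{n_0(G')\mid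 G' \text{ consists of some connected components of } G\}$. *)

(* Defs.v *)
From HB Require Import structures.
From mathcomp Require Import all_boot all_order all_algebra.
From mathcomp Require Export mpoly.

Set Implicit Arguments.
Unset Strict Implicit.
Unset Printing Implicit Defensive.

Import GRing.Theory.
Local Open Scope ring_scope.

Section Ideals.
Variable R : comNzRingType.
Implicit Types (I J P S : R -> Prop).

Definition is_ideal I : Prop :=
  [/\ I 0, forall x y, I x -> I y -> I (x + y) & forall a x, I x -> I (a * x)].

Definition is_prime_ideal P : Prop :=
  [/\ is_ideal P, ~ P 1 & forall x y, P (x * y) -> P x \/ P y].

Definition ideal_gen S : R -> Prop :=
  fun x => exists2 s : seq (R * R),
    forall p, p \in s -> S p.2 & x = \sum_(p <- s) p.1 * p.2.

Definition ideal_mul I J : R -> Prop :=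
  ideal_gen (fun z => exists x y, [/\ I x, J y & z = x * y]).

Fixpoint ideal_pow I (n : nat) : R -> Prop :=
  if n is m.+1 then ideal_mul I (ideal_pow I m) else fun=> True.

Definition integral_closure J : R -> Prop :=
  fun x => exists2 n, (1 <= n)%N & exists2 a : nat -> R,
    forall i, (1 <= i <= n)%N -> ideal_pow J i (a i)
    & x ^+ n + \sum_(1 <= i < n.+1) a i * x ^+ (n - i) = 0.

(* P is an associated prime of the R-module R/I: a prime ideal that is the
   annihilator of the class of some f. *)
Definition Ass I P : Prop :=
  is_prime_ideal P /\ exists f, forall g, P g <-> I (g * f).

Definition Ass_bar_stable_from I n0 : Prop :=
  forall n, (n0 <= n)%N -> forall P,
    Ass (integral_closure (ideal_pow I n)) P
    <-> Ass (integral_closure (ideal_pow I n0)) P.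

(* a is the least n0 >= 1 from which Ass(R / bar(I^n)) is constant. *)
Definition is_astab_bar I (a : nat) : Prop :=
  [/\ (1 <= a)%N, Ass_bar_stable_from I a
    & forall n0, (1 <= n0)%N -> Ass_bar_stable_from I n0 -> (a <= n0)%N].

End Ideals.

Definition edge_ideal (K : fieldType) (r : nat) (e : rel 'I_r) :
    {mpoly K[r]} -> Prop :=
  ideal_gen (fun m => exists i j, e i j /\ m = 'X_i * 'X_j).
Arguments edge_ideal K {r} e.

(* A simple graph on T is a symmetric irreflexive relation e; below, a vertex
   set A stands for the induced subgraph G[A]. *)
Section Graphs.
Variables (T : finType) (e : rel T).
Implicit Types A C : {set T}.
Local Open Scope nat_scope.

Definition induced A : rel T := [rel x y | [&& x \in A, y \in A & e x y]].

Definition components A : {set {set T}} :=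
  equivalence_partition (connect (induced A)) A.

Definition bipartite A : bool :=
  [exists B : {set T},
    [forall x, [forall y, induced A x y ==> ((x \in B) != (y \in B))]]].

Definition degree A x : nat := #|[set y | induced A x y]|.

Definition edges A : {set {set T}} :=
  [set E | [exists x, [exists y, induced A x y && (E == [set x; y])]]].

Definition leaf_edges A : {set {set T}} :=
  [set E in edges A | [exists x in E, degree A x == 1]].

(* For irreflexive e, simple e-cycles of odd size have at least 3 vertices, so
   they are exactly the odd cycles in the usual sense. *)
Definition has_cycle A (m : nat) : bool :=
  [exists c : m.-tuple T, ucycleb (induced A) c].

(* Minimum length of an odd cycle of G[A] (#|A|.+1 if G[A] is bipartite): the
   index of m in iota 0 _ is m itself. *)
Definition odd_girth A : nat :=
  find (fun m => odd m && has_cycle A m) (iota 0 #|A|.+1).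

(* The k such that odd_girth A = 2k - 1 *)
Definition half_odd_girth A : nat := uphalf (odd_girth A).

Definition nonbip_components A : {set {set T}} :=
  [set C in components A | ~~ bipartite C].

(* The subtractions never truncate: a nonbipartite component C has at least
   odd_girth C vertices that are not leaves. *)
Definition n0 A : nat :=
  let s := #|nonbip_components A| in
  let S := \sum_(C in nonbip_components A)
             (#|C| - #|leaf_edges C| - half_odd_girth C) in
  if s == 0 then 1
  else if odd s then S + s./2 + 1
  else S + s./2 + half_odd_girth A.

(* The empty choice of components contributes the value 1; this makes
   phi0 = 1 for the graph without vertices and is otherwise immaterial. *)
Definition phi0 : nat :=
  \max_(F : {set {set T}} | F \subset components [set: T]) n0 (cover F).

End Graphs.

(* Main.v *)
Require Import Defs.
From HB Require Import structures.
From mathcomp Require Import all_boot all_algebra.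
From mathcomp Require Import zify.
From Stdlib Require Import Classical ClassicalEpsilon.

Set Implicit Arguments.
Unset Strict Implicit.
Unset Printing Implicit Defensive.
Import GRing.Theory.

(** Let I be the edge ideal of the graph and bar(I^n) the integral closure of
    its n-th power.

    Membership in bar(I^n) is decided monomial by monomial: X^a belongs to it
    iff w.a >= 2n for every vertex weight w with values in {0,1,2} such that
    w i + w j >= 2 on each edge ([integral_closure_edge_pow]).  Necessity is a
    valuation argument: substituting X_i t^(w i) for X_i makes the order in t a
    valuation that is at least 2 on I.  For sufficiency, the weighted Koenig
    theorem on the bipartite double cover ([koenig]) packs 2n edges into the
    vector 2a, so that (X^a)^2 is in (I^n)^2; and a sum of elements z with
    z^2 in J^2 is integral over J, because the elements integral over the Rees
    algebra form a ring ([integral_closure_sum]).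

    Thus bar(I^n) is a finite intersection of valuation ideals, and a prime of
    the form (bar(I^n) : f) is generated by the variables in the support F of
    one of the weights ([Ass_edge_pow]).  What remains of f is a vector a with
    w.a < 2n, while every weight w' satisfies w'.a + w' i >= 2n for i in F.
    Let U be the set of the vertices of F all of whose neighbours are in F.
    If such an a exists, then F is a vertex cover and some vector b on U is
    expanding: b(N(S)) > b(S) for all nonempty independent S in U, with the
    neighbourhood taken in U ([core_expanding]).  Conversely such an a exists
    for n >= 1 and a vertex cover F as soon as U is empty or carries an
    expanding vector of odd total 2k - 1 with k <= n ([expanding_assoc]); for
    adding the endpoints of an edge of G[U] keeps a vector expanding.  So what
    matters is how small an odd total can be on a set U that carries some
    expanding vector.

    An expanding vector excludes bipartite components of G[U], since for the
    two sides X and Y it would give b(X) < b(Y) < b(X).  So each component of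
    G[U] contains an odd cycle ([expanding_odd_cycle]).  Conversely the sum of
    the indicators of these cycles, one for each component, becomes expanding
    after adding, for each further vertex u that is not a leaf of G, the
    endpoints of one edge from u to a vertex reached before.  The total is then
    twice the number of nonleaves reached minus the sum of the lengths of the
    cycles ([expanding_from_cycles]).  If the number of cycles is even, one of
    them is counted twice to make the total odd, and its length leaves that sum.

    Finally let G' be the union of the components of G that meet U.  A cycle of
    G[U] is at least as long as the odd girth of the component of G around it,
    so the total is at most 2 n0(G') - 1 once the doubled cycle is chosen well
    ([odd_selection]): in a component of G that contains two of the cycles if
    the number of components of G' is odd, and in one that realizes the odd
    girth of G' if it is even ([n0_bound]). *)

(** * Sums over a vertex set *)

Section Sums.
Variable T : finType.
Implicit Types (a : T -> nat) (S : {set T}).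

Lemma sum_indic a S : \sum_(x in S) a x = \sum_x (x \in S) * a x.
Proof.
by rewrite big_mkcond; apply: eq_bigr => x _; case: (x \in S); rewrite ?mul1n.
Qed.

Lemma sum_pred1 S u : \sum_(z in S) (z == u) = (u \in S).
Proof.
have [uS|uS] := boolP (u \in S); last first.
  by rewrite big1 // => z zS; apply/eqP; rewrite eqb0; apply: contra uS => /eqP<-.
by rewrite (bigD1 u) //= eqxx big1 // => z /andP[_ /negPf->].
Qed.

Lemma sum_pred2 S x y : x \in S -> y \in S ->
  \sum_(z in S) ((z == x) + (z == y)) = 2.
Proof. by move=> xS yS; rewrite big_split /= !sum_pred1 xS yS. Qed.

End Sums.

(** * Weights and the order of a polynomial along a weight *)

(** Twice the half-integral vertex covers: the inequalities w.a >= 2n for these w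
    define n times the Newton polyhedron of the edge ideal. *)
Definition half_cover (T : finType) (e : rel T) (w : {ffun T -> 'I_3}) : bool :=
  [forall i, forall j, e i j ==> (2 <= w i + w j)].

Definition dot (T : finType) (w : {ffun T -> 'I_3}) (a : T -> nat) : nat :=
  \sum_i w i * a i.

(** Substituting X_i t^(w i) for X_i turns the weight of a monomial into a power
    of t, so that the order along w is read off as an order in t. *)
HB.lock Definition weight_subst (K : fieldType) (r : nat) (w : {ffun 'I_r -> 'I_3})
    (f : {mpoly K[r]}) : {poly {mpoly K[r]}} :=
  mmap (polyC \o @mpolyC r K) (fun i => ('X_i)%:P * 'X^(w i))%R f.

Section WeightOrder.
Variables (K : fieldType) (r : nat).
Implicit Types (w : {ffun 'I_r -> 'I_3}) (f g : {mpoly K[r]}).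
Local Open Scope ring_scope.

Lemma weight_subst0 w : weight_subst w (0 : {mpoly K[r]}) = 0.
Proof. by rewrite unlock; exact: raddf0. Qed.
Lemma weight_subst1 w : weight_subst w (1 : {mpoly K[r]}) = 1.
Proof. by rewrite unlock; exact: rmorph1. Qed.
Lemma weight_substD w f g :
  weight_subst w (f + g) = weight_subst w f + weight_subst w g.
Proof. by rewrite unlock; exact: raddfD. Qed.
Lemma weight_substM w f g :
  weight_subst w (f * g) = weight_subst w f * weight_subst w g.
Proof. by rewrite unlock; exact: rmorphM. Qed.

Lemma mmap1_weight w (m : 'X_{1..r}) :
  mmap1 (fun i => ('X_i)%:P * 'X^(w i) : {poly {mpoly K[r]}}) m
  = ('X_[m])%:P * 'X^(dot w m).
Proof.
rewrite /mmap1 mpolyXE_id rmorph_prod /=.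
under eq_bigr do rewrite exprMn -exprM -rmorphXn /=.
rewrite big_split /=; congr (_ * _).
by rewrite /dot; elim/big_rec2: _ => [|i y1 y2 _ ->]; rewrite ?expr0 // exprD.
Qed.

Lemma coef_weight_subst w f d m :
  ((weight_subst w f)`_d)@_m = if dot w m == d then f@_m else 0.
Proof.
rewrite unlock /mmap coef_sum raddf_sum /=.
under eq_bigr => m' _.
  rewrite mmap1_weight mulrA -polyCM coefCM coefXn mulr_natr mcoeffMn mcoeffCM mcoeffX.
  over.
have [mf|mf] := boolP (m \in msupp f).
  rewrite (bigD1_seq m) //= ?msupp_uniq // eqxx big1 ?addr0 => [|m' /negPf->].
    by rewrite eq_sym; case: eqP; rewrite ?mulr1 ?mulr0.
  by rewrite mulr0 mul0rn.
rewrite big1_seq ?(memN_msupp_eq0 mf) ?if_same // => m' /= m'f.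
have [mm|_] := eqVneq m' m; last by rewrite mulr0 mul0rn.
by rewrite -mm m'f in mf.
Qed.

(** Coefficients rather than monomials, for the sake of the product formula
    [ord_ge_coefM]. *)
Definition ord_ge w d f := forall k, (k < d)%N -> (weight_subst w f)`_k = 0.

Lemma ord_geP w d f :
  ord_ge w d f <-> {in msupp f, forall m : 'X_{1..r}, (d <= dot w m)%N}.
Proof.
split=> [lf m mf|lf k kd].
  rewrite leqNgt; apply/negP=> md; move: mf; rewrite mcoeff_msupp.
  by have := coef_weight_subst w f (dot w m) m; rewrite lf // mcoeff0 eqxx => <-; rewrite eqxx.
apply/mpolyP=> m; rewrite coef_weight_subst mcoeff0; case: eqP => // dm.
apply: memN_msupp_eq0; apply/negP=> /lf; lia.
Qed.

Lemma ord_ge_ideal w d : is_ideal (ord_ge w d).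
Proof.
split=> [k|x y lx ly k kd|a x lx k kd]; first by rewrite weight_subst0 coef0.
  by rewrite weight_substD coefD lx ?ly ?addr0.
by rewrite weight_substM coefM big1 // => i _; rewrite lx ?mulr0 //; have := ltn_ord i; lia.
Qed.

(** Only the product of the two initial forms contributes to t^(a + b). *)
Lemma ord_ge_coefM w a b f g : ord_ge w a f -> ord_ge w b g ->
  (weight_subst w (f * g))`_(a + b) = (weight_subst w f)`_a * (weight_subst w g)`_b.
Proof.
move=> lf lg; rewrite weight_substM coefM.
have ha : (a < (a + b).+1)%N by lia.
rewrite (bigD1 (Ordinal ha)) //= addKn big1 ?addr0 // => i.
rewrite -val_eqE /= => ia; have := ltn_ord i => ib.
have [ilt|ige] := ltnP i a; first by rewrite lf ?mul0r.
by rewrite lg ?mulr0 //; lia.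
Qed.

Lemma ord_geM w a b f g : ord_ge w a f -> ord_ge w b g -> ord_ge w (a + b) (f * g).
Proof.
move=> lf lg k kab; rewrite weight_substM coefM big1 // => i _.
have := ltn_ord i => ib; have [ilt|ige] := ltnP i a; first by rewrite lf ?mul0r.
by rewrite lg ?mulr0 //; lia.
Qed.

Lemma ord_ge0 w f : ord_ge w 0 f. Proof. by []. Qed.

Lemma ord_ge_leq w a b f : (a <= b)%N -> ord_ge w b f -> ord_ge w a f.
Proof. by move=> ab lf k ka; apply: lf; lia. Qed.

Lemma weight_subst_eq0 w f : (forall k, (weight_subst w f)`_k = 0) -> f = 0.
Proof.
move=> f0; apply/mpolyP=> m; have := coef_weight_subst w f (dot w m) m.
by rewrite f0 eqxx mcoeff0.
Qed.

Lemma exists_order w f : f != 0 -> exists2 d, ord_ge w d f & (weight_subst w f)`_d != 0.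
Proof.
move=> f0; have ex : exists k, (weight_subst w f)`_k != 0.
  apply: NNPP => nex; move: f0; rewrite (@weight_subst_eq0 w f) ?eqxx // => k.
  by apply/eqP/negPn/negP=> nk; apply: nex; exists k.
exists (ex_minn ex); case: ex_minnP => // d _ dmin k kd.
by apply/eqP; apply: contraTT kd => /dmin; rewrite -leqNgt.
Qed.

Lemma ord_geXn w d f N : ord_ge w d f ->
  ord_ge w (N * d) (f ^+ N) /\
  (weight_subst w (f ^+ N))`_(N * d) = (weight_subst w f)`_d ^+ N.
Proof.
move=> lf; elim: N => [|N [IH1 IH2]]; first by rewrite mul0n !expr0 weight_subst1 coefC.
by rewrite !exprS mulSn ord_ge_coefM // IH2; split=> //; apply: ord_geM.
Qed.

Lemma ord_ge_ideal_pow w d (J : {mpoly K[r]} -> Prop) :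
  (forall f, J f -> ord_ge w d f) -> forall i f, ideal_pow J i f -> ord_ge w (i * d) f.
Proof.
move=> Jl; elim=> [//|i IH] f [s sP ->].
have [l0 lD lM] := ord_ge_ideal w (i.+1 * d); rewrite big_seq.
elim/big_ind: _ => // p /sP [x [y [Jx Jy ->]]]; apply: lM.
by rewrite mulSn; apply: ord_geM; [apply: Jl|apply: IH].
Qed.

(** If f had order v < d, then in an integral equation of degree n the term f^n
    would have order exactly nv, as initial forms multiply in a domain, and every
    other term a_i f^(n-i) an order of at least id + (n-i)v, which is larger. *)
Lemma ord_ge_integral_closure w d (J : {mpoly K[r]} -> Prop) :
  (forall f, J f -> ord_ge w d f) -> forall f, integral_closure J f -> ord_ge w d f.
Proof.
move=> Jl f [n n1 [a aJ eq0]].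
have [->|f0] := eqVneq f 0; first by have [] := ord_ge_ideal w d.
have [v lv nv] := exists_order w f0.
have [dv|vd] := leqP d v; first exact: ord_ge_leq lv.
have [_ cN] := ord_geXn n lv; have := expf_neq0 n nv; rewrite -cN.
have ls : ord_ge w (n * v).+1 (\sum_(1 <= i < n.+1) a i * f ^+ (n - i)).
  rewrite big_nat; have [l0 lD _] := ord_ge_ideal w (n * v).+1.
  elim/big_ind: _ => // i /andP [i1 iln].
  apply: (@ord_ge_leq _ _ (i * d + (n - i) * v)); first by nia.
  apply: ord_geM; last by case: (ord_geXn (n - i) lv).
  by apply: ord_ge_ideal_pow Jl _ _ _; apply: aJ; lia.
have: (weight_subst w (f ^+ n + \sum_(1 <= i < n.+1) a i * f ^+ (n - i)))`_(n * v) = 0.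
  by rewrite eq0 weight_subst0 coef0.
by rewrite weight_substD coefD ls // addr0 => ->; rewrite eqxx.
Qed.

End WeightOrder.

(** * Integral elements via the Rees algebra *)

Section IdealPowers.
Variable R : comNzRingType.
Implicit Types (I J S : R -> Prop).
Local Open Scope ring_scope.

Lemma ideal_gen_is_ideal S : is_ideal (ideal_gen S).
Proof.
split=> [|x y [s sP ->] [t tP ->]|a x [s sP ->]].
- by exists [::]; rewrite ?big_nil.
- exists (s ++ t); last by rewrite big_cat.
  by move=> p; rewrite mem_cat => /orP[/sP|/tP].
exists [seq (a * p.1, p.2) | p <- s]; first by move=> _ /mapP[p /sP ? ->].
by rewrite big_map mulr_sumr; apply: eq_bigr => p _; rewrite mulrA.
Qed.

Lemma ideal_gen_mem S x : S x -> ideal_gen S x.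
Proof.
by exists [:: (1, x)]; rewrite ?big_seq1 ?mul1r // => p; rewrite inE => /eqP->.
Qed.

Lemma ideal_gen_min S I : is_ideal I -> (forall x, S x -> I x) ->
  forall x, ideal_gen S x -> I x.
Proof.
move=> [I0 ID IM] SI x [s sP ->]; rewrite big_seq.
by elim/big_ind: _ => // p /sP /SI; apply: IM.
Qed.

Lemma ideal_pow_ideal J n : is_ideal (ideal_pow J n).
Proof. by case: n => [|n]; [split|apply: ideal_gen_is_ideal]. Qed.

Lemma ideal_powS J n x y : J x -> ideal_pow J n y -> ideal_pow J n.+1 (x * y).
Proof. by move=> Jx Jy; apply: ideal_gen_mem; exists x, y. Qed.

Lemma ideal_powM J i j x y :
  ideal_pow J i x -> ideal_pow J j y -> ideal_pow J (i + j) (x * y).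
Proof.
elim: i x => [|i IH] x Jx Jy; first by have [_ _] := ideal_pow_ideal J j; apply.
have [J0 JD JM] := ideal_pow_ideal J (i.+1 + j).
pose I z := ideal_pow J (i.+1 + j) (z * y).
apply: (@ideal_gen_min _ I) Jx => [|_ [u [v [Ju Jv ->]]]].
  rewrite /I; split=> [|a b ? ?|a b ?]; first by rewrite mul0r.
    by rewrite mulrDl; apply: JD.
  by rewrite -mulrA; apply: JM.
by rewrite /I -mulrA addSn; apply: ideal_powS => //; apply: IH.
Qed.

End IdealPowers.

Section Rees.
Variables (R : comNzRingType) (J : R -> Prop).
Local Open Scope ring_scope.

(** The Rees algebra of J inside R[t]; decidable membership is what the subtype
    construction of a subring asks for. *)
Definition rees : {pred {poly R}} := fun p =>
  if excluded_middle_informative (forall i, ideal_pow J i p`_i) then true else false.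

Lemma reesP (p : {poly R}) : reflect (forall i, ideal_pow J i p`_i) (p \in rees).
Proof.
by rewrite unfold_in; case: excluded_middle_informative => h; constructor.
Qed.

Fact rees_subring : subring_closed rees.
Proof.
split=> [|p q /reesP Jp /reesP Jq|p q /reesP Jp /reesP Jq]; apply/reesP => i;
  have [J0 JD JM] := ideal_pow_ideal J i.
- by rewrite coef1; case: i J0 {JD JM}.
- by rewrite coefB -[- _]mulN1r; apply: JD => //; apply: JM.
rewrite coefM; elim/big_ind: _ => // j _.
by have := ideal_powM (Jp j) (Jq (i - j)%N); rewrite subnKC // -ltnS.
Qed.
HB.instance Definition _ := GRing.isSubringClosed.Build _ rees rees_subring.

Record rees_ring := Rees { rees_val :> {poly R}; _ : rees_val \in rees }.
HB.instance Definition _ := [isSub for rees_val].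
HB.instance Definition _ := [Choice of rees_ring by <:].
HB.instance Definition _ := [SubChoice_isSubComNzRing of rees_ring by <:].
HB.instance Definition _ := GRing.RMorphism.copy rees_val (val : rees_ring -> _).

(** In a monic equation of degree N for xt over the Rees algebra, the coefficient
    of t^N is an equation of integral dependence of x on J. *)
Lemma integral_closure_of_rees x :
  integralOver rees_val (x%:P * 'X) -> integral_closure J x.
Proof.
move=> [q q_monic /rootP]; set qv := map_poly _ q => qx0.
have qv_monic : qv \is monic by rewrite /qv monic_map.
have sq : size qv = (size q).-1.+1.
  rewrite /qv size_map_poly_id0 ?(monicP q_monic) ?rmorph1 ?oner_neq0 //.
  by rewrite prednK // lt0n size_poly_eq0 monic_neq0.
set N := (size q).-1 in sq.
have lead : qv`_N = 1 by move/monicP: qv_monic; rewrite /lead_coef sq.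
have key : x ^+ N + \sum_(1 <= i < N.+1) (qv`_(N - i))`_i * x ^+ (N - i) = 0.
  have := congr1 (fun p : {poly R} => p`_N) qx0; rewrite coef0 horner_coef sq coef_sum.
  under eq_bigr => i _.
    rewrite exprMn mulrA coefMXn ltnNge -ltnS ltn_ord /= -rmorphXn /= coefMC.
    over.
  rewrite -(big_mkord xpredT (fun i => (qv`_i)`_(N - i) * x ^+ i)).
  rewrite big_nat_rev /= add0n big_nat_recl // !subSS subn0 lead subnn coef1 mul1r.
  move=> e0; rewrite -[RHS]e0; congr (_ + _); rewrite big_add1 /=.
  apply: eq_big_nat => i /andP[_ iN].
  have -> : (N.+1 - i.+2 = N - i.+1)%N by lia.
  by have -> : (N - (N - i.+1) = i.+1)%N by lia.
have [N0|N0] := posnP N.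
  move: key; rewrite N0 expr0 big_geq // addr0 => /eqP; by rewrite oner_eq0.
exists N => //; exists (fun i => (qv`_(N - i))`_i) => // i _.
by rewrite /qv coef_map; case: (q`_(N - i)) => p /= /reesP.
Qed.

Lemma rees_integral_sqrt z : ideal_pow J 2 (z ^+ 2) ->
  integralOver rees_val (z%:P * 'X).
Proof.
move=> Jz2; have hz : (z ^+ 2)%:P * 'X^2 \in rees.
  apply/reesP=> i; rewrite coefCM coefXn; case: eqP => [->|_]; first by rewrite mulr1.
  by rewrite mulr0; case: (ideal_pow_ideal J i).
exists ('X^2 - (Rees hz)%:P); first exact: monicXnsubC.
rewrite rootE rmorphB /=. rewrite map_polyXn map_polyC /= !hornerE exprMn -rmorphXn /=.
by rewrite expr2 mulrA subrr.
Qed.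

(** An element z with z^2 in J^2 makes zt a square root of an element of the Rees
    algebra, and integral elements are closed under addition. *)
Lemma integral_closure_sum (s : seq R) :
  (forall z, z \in s -> ideal_pow J 2 (z ^+ 2)) ->
  integral_closure J (\sum_(z <- s) z).
Proof.
move=> sJ; apply: integral_closure_of_rees; rewrite rmorph_sum mulr_suml big_seq.
elim/big_ind: _ => [|x y ix iy|z zs]; first exact: integral0.
  exact: integral_add.
by apply: rees_integral_sqrt; apply: sJ.
Qed.

End Rees.

(** * Weighted Koenig theorem *)

Section Koenig.
Variables (T : finType) (e : rel T).
Implicit Types (a b : T -> nat) (X Y : {set T}) (M : seq (T * T)).

Definition covers X Y := [forall i, forall j, e i j ==> (i \in X) || (j \in Y)].

Definition cover_weight a b X Y := (\sum_(i in X) a i) + \sum_(j in Y) b j.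

Definition capacitated a b M :=
  [/\ forall p, p \in M -> e p.1 p.2,
      forall i, count (fun p => p.1 == i) M <= a i
    & forall j, count (fun p => p.2 == j) M <= b j].

Lemma sum_restrict a X Y :
  \sum_(i in X) (if i \in Y then a i else 0) = \sum_(i in X :&: Y) a i.
Proof. by rewrite -big_mkcondr; apply: eq_bigl => i; rewrite inE. Qed.

Lemma sum_decrement a X i : 0 < a i ->
  \sum_(x in X) a x = \sum_(x in X) (a x - (x == i)) + (i \in X).
Proof.
move=> ai; have [iX|iX] := boolP (i \in X); last first.
  rewrite addn0; apply: eq_bigr => x xX; have [xi|_] := eqVneq x i; last by rewrite subn0.
  by rewrite xi (negPf iX) in xX.
rewrite !(bigD1 i iX) /= eqxx addnAC subnK //; congr (_ + _).
by apply: eq_bigr => x /andP[_ /negPf->]; rewrite subn0.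
Qed.

Lemma sum_setU a X Y :
  \sum_(i in X :|: Y) a i = \sum_(i in X) a i + \sum_(i in Y :&: ~: X) a i.
Proof. by rewrite (big_setID X) /= setUK setDUl setDv set0U setDE. Qed.

(** Covers form a lattice; this uncrossing and the next one are what allows a
    tight cover to be split. *)
Lemma covers_setI_setU X1 Y1 X2 Y2 : covers X1 Y1 -> covers X2 Y2 ->
  covers (X1 :&: X2) (Y1 :|: Y2).
Proof.
move=> /forallP c1 /forallP c2; apply/forallP=> i; apply/forallP=> j.
have /forallP/(_ j) := c1 i; have /forallP/(_ j) := c2 i; rewrite !inE.
by case: (e i j) => //=; case: (i \in X2); case: (j \in Y2); case: (i \in X1);
  case: (j \in Y1).
Qed.

Lemma covers_setU_setI X1 Y1 X2 Y2 : covers X1 Y1 -> covers X2 Y2 ->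
  covers (X1 :|: X2) (Y1 :&: Y2).
Proof.
move=> /forallP c1 /forallP c2; apply/forallP=> i; apply/forallP=> j.
have /forallP/(_ j) := c1 i; have /forallP/(_ j) := c2 i; rewrite !inE.
by case: (e i j) => //=; case: (i \in X2); case: (j \in Y2); case: (i \in X1);
  case: (j \in Y1).
Qed.

(** Induction on k.  A cover of weight exactly k with both parts of positive
    weight splits the problem into the edges from X to the complement of Y and the
    edges from the complement of X to Y.  When there is no such cover, any edge with
    positive capacities at both ends can be matched first: a cover whose weight
    drops by two has both parts of positive weight, hence weight at least k+1. *)
Lemma koenig k a b :
  (forall X Y, covers X Y -> k <= cover_weight a b X Y) ->
  exists2 M, size M = k & capacitated a b M.
Proof.
elim/ltn_ind: k a b => k IH a b kmin.
have [k0|k0] := posnP k; first by exists [::]; rewrite ?k0.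
have [[X [Y [cXY kE aX bY]]]|notight] :=
  classic (exists X Y, [/\ covers X Y, cover_weight a b X Y = k,
    0 < \sum_(i in X) a i & 0 < \sum_(j in Y) b j]).
  set a1 := fun i => if i \in X then a i else 0.
  set b1 := fun j => if j \in ~: Y then b j else 0.
  set a2 := fun i => if i \in ~: X then a i else 0.
  set b2 := fun j => if j \in Y then b j else 0.
  rewrite /cover_weight in kE.
  have [|X' Y' c'|M1 s1 [e1 l1 r1]] := IH (\sum_(i in X) a i) _ a1 b1; first by lia.
    rewrite /cover_weight !sum_restrict; have := kmin _ _ (covers_setI_setU cXY c').
    by rewrite /cover_weight sum_setU [X :&: X']setIC; lia.
  have [|X' Y' c'|M2 s2 [e2 l2 r2]] := IH (\sum_(j in Y) b j) _ a2 b2; first by lia.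
    rewrite /cover_weight !sum_restrict; have := kmin _ _ (covers_setU_setI cXY c').
    by rewrite /cover_weight sum_setU [Y :&: Y']setIC; lia.
  exists (M1 ++ M2); first by rewrite size_cat s1 s2.
  split=> [p|i|j]; rewrite ?mem_cat ?count_cat; first by move=> /orP[/e1|/e2].
    have := l1 i; have := l2 i; rewrite /a1 /a2 inE; case: (i \in X) => /=; lia.
  have := r1 j; have := r2 j; rewrite /b1 /b2 inE; case: (j \in Y) => /=; lia.
have [i [j [eij ai bj]]] : exists i j, [/\ e i j, 0 < a i & 0 < b j].
  apply: NNPP => none; have: covers [set i | a i == 0] [set j | b j == 0].
    apply/forallP=> i; apply/forallP=> j; apply/implyP=> eij; rewrite !inE.
    have [_|ai] //= := posnP (a i); have [_|bj] // := posnP (b j).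
    by case: none; exists i, j.
  move=> /kmin; rewrite /cover_weight !big1; first lia.
    by move=> j; rewrite inE => /eqP.
  by move=> j; rewrite inE => /eqP.
have [|X Y cXY|M sM [eM lM rM]] :=
    IH k.-1 _ (fun x => a x - (x == i)) (fun y => b y - (y == j)); first by lia.
  have := kmin _ _ cXY; rewrite /cover_weight (sum_decrement X ai) (sum_decrement Y bj).
  case iX: (i \in X); case jY: (j \in Y) => /=; try lia.
  move=> kle; rewrite leqNgt; apply/negP=> klt; apply: notight; exists X, Y.
  rewrite /cover_weight (sum_decrement X ai) (sum_decrement Y bj) iX jY.
  by split=> //; lia.
exists ((i, j) :: M); first by rewrite /= sM; lia.
split=> [p|x|y] /=; first by rewrite inE => /predU1P[-> //|/eM].
  have := lM x; rewrite eq_sym; have [<-|_] := eqVneq i x; rewrite /=; lia.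
have := rM y; rewrite eq_sym; have [<-|_] := eqVneq j y; rewrite /=; lia.
Qed.

End Koenig.

(** * Integral closures of powers of an edge ideal *)

Section Dot.
Variables (T : finType) (e : rel T).
Implicit Types (w : {ffun T -> 'I_3}) (a b : T -> nat).

Lemma half_coverP w :
  reflect (forall i j, e i j -> 2 <= w i + w j) (half_cover e w).
Proof.
apply: (iffP forallP) => [h i j eij|h i]; last by apply/forallP=> j; apply/implyP/h.
by have /forallP/(_ j) := h i; rewrite eij.
Qed.

Lemma dotD w a b : dot w (fun i => a i + b i) = dot w a + dot w b.
Proof. by rewrite /dot -big_split; apply: eq_bigr => i _; rewrite mulnDr. Qed.

Lemma dot_delta w i : dot w (fun j => i == j) = w i.
Proof.
rewrite /dot (bigD1 i) //= eqxx muln1 big1 ?addn0 // => j /negPf ji.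
by rewrite eq_sym ji muln0.
Qed.

Lemma eq_dot w a b : a =1 b -> dot w a = dot w b.
Proof. by move=> ab; apply: eq_bigr => i _; rewrite ab. Qed.

(** A cover (X, Y) of the bipartite double cover is the half-integral cover
    1_X + 1_Y of the graph itself. *)
Lemma half_integral_matching k a : symmetric e ->
  (forall w, half_cover e w -> k <= dot w a) ->
  exists2 M : seq (T * T), size M = k & capacitated e a a M.
Proof.
move=> e_sym kmin; apply: koenig => X Y /forallP cXY.
have w2 i : (i \in X) + (i \in Y) < 3 by case: (i \in X); case: (i \in Y).
have /kmin : half_cover e [ffun i => Ordinal (w2 i)].
  apply/half_coverP=> i j eij; rewrite !ffunE /=.
  have /forallP/(_ j) := cXY i; have /forallP/(_ i) := cXY j; rewrite e_sym eij /=.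
  by case: (i \in X); case: (i \in Y); case: (j \in X); case: (j \in Y).
rewrite /dot /cover_weight; under eq_bigr do rewrite ffunE /= mulnDl.
by rewrite big_split /= !sum_indic.
Qed.

End Dot.

Section EdgeIdeal.
Variables (K : fieldType) (r : nat) (e : rel 'I_r).
Hypothesis e_sym : symmetric e.
Implicit Types (w : {ffun 'I_r -> 'I_3}) (m : 'X_{1..r}).
Local Open Scope ring_scope.
Let I := edge_ideal K e.

Lemma dot_mnmD w m1 m2 : dot w (m1 + m2)%MM = (dot w m1 + dot w m2)%N.
Proof. by rewrite -dotD; apply: eq_dot => i; rewrite mnmDE. Qed.

Lemma dot_mnm1 w i : dot w U_(i)%MM = w i.
Proof. by rewrite -[RHS]dot_delta; apply: eq_dot => j; rewrite mnm1E. Qed.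

Lemma ord_ge_edge_ideal w f : half_cover e w -> I f -> ord_ge w 2 f.
Proof.
move=> /half_coverP cw; apply: ideal_gen_min; first exact: ord_ge_ideal.
move=> _ [i [j [eij ->]]]; rewrite -mpolyXD; apply/ord_geP=> m; rewrite msuppX inE.
by move=> /eqP->; rewrite dot_mnmD !dot_mnm1 cw.
Qed.

Lemma edge_monomial (M : seq ('I_r * 'I_r)) : (forall p, p \in M -> e p.1 p.2) ->
  ideal_pow I (size M) 'X_[(\sum_(p <- M) (U_(p.1) + U_(p.2)))%MM].
Proof.
elim: M => [//|p M IH] eM; rewrite big_cons mpolyXD; apply: ideal_powS.
  apply: ideal_gen_mem; exists p.1, p.2; rewrite mpolyXD; split=> //.
  by apply: eM; rewrite inE eqxx.
by apply: IH => q qM; apply: eM; rewrite inE qM orbT.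
Qed.

(** The 2n matched edges fit into 2m; split into two halves they give two
    generators of I^n whose product divides the square of the monomial. *)
Lemma sqr_monomial_in_pow n m :
  (forall w, half_cover e w -> (n * 2 <= dot w m)%N) ->
  ideal_pow (ideal_pow I n) 2 ('X_[m] ^+ 2).
Proof.
move=> mn; have [M sM [eM lM rM]] := half_integral_matching e_sym mn.
set M1 := take n M; set M2 := drop n M.
have s1 : size M1 = n by rewrite size_take sM; case: ltnP; lia.
have s2 : size M2 = n by rewrite size_drop sM; lia.
have J1 : ideal_pow I n 'X_[(\sum_(p <- M1) (U_(p.1) + U_(p.2)))%MM].
  by rewrite -{1}s1; apply: edge_monomial => p /mem_take; apply: eM.
have J2 : ideal_pow I n 'X_[(\sum_(p <- M2) (U_(p.1) + U_(p.2)))%MM].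
  by rewrite -{1}s2; apply: edge_monomial => p /mem_drop; apply: eM.
set m1 := (\sum_(p <- M1) _)%MM in J1; set m2 := (\sum_(p <- M2) _)%MM in J2.
have le : (m1 + m2 <= m + m)%MM.
  apply/mnm_lepP=> i; rewrite /m1 /m2 -big_cat cat_take_drop mnm_sumE mnmDE.
  under eq_bigr do rewrite mnmDE !mnm1E.
  have sum_count (P : pred ('I_r * 'I_r)) : (\sum_(p <- M) P p)%N = count P M.
    by rewrite -sum1_count [RHS]big_mkcond; apply: eq_bigr => p _; case: (P p).
  by rewrite big_split /= !sum_count leq_add.
rewrite expr2 -mpolyXD -(submK le) mpolyXD.
have [_ _] := ideal_pow_ideal (ideal_pow I n) 2; apply.
by rewrite mpolyXD -[X in _ * X]mulr1; do 2!apply: ideal_powS => //.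
Qed.

Lemma integral_closure_edge_pow n f :
  integral_closure (ideal_pow I n) f <->
  forall m w, m \in msupp f -> half_cover e w -> (n * 2 <= dot w m)%N.
Proof.
split=> [cf m w mf cw|mf].
  have lI g : ideal_pow I n g -> ord_ge w (n * 2) g.
    by apply: ord_ge_ideal_pow => g' ; apply: ord_ge_edge_ideal.
  by have /ord_geP := ord_ge_integral_closure lI cf; apply.
rewrite [f]mpolyE -(big_map (fun m => f@_m *: 'X_[m]) xpredT id).
apply: integral_closure_sum => _ /mapP[m msf ->].
rewrite exprZn -mul_mpolyC; have [_ _] := ideal_pow_ideal (ideal_pow I n) 2; apply.
by apply: sqr_monomial_in_pow => w; apply: mf.
Qed.

End EdgeIdeal.

(** * Associated primes *)

(** The prime generated by the variables in F is associated to the integral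
    closure of the n-th power: a is the exponent of a monomial outside that
    closure which each variable in F multiplies into it, and w is a weight that
    keeps it outside under multiplication by the variables not in F. *)
Definition assoc_at (T : finType) (e : rel T) (n : nat) (F : {set T}) : Prop :=
  exists2 w : {ffun T -> 'I_3}, half_cover e w /\ (forall i, (i \in F) = (0 < w i))
  & exists2 a : T -> nat, dot w a < n * 2
  & forall (w' : {ffun T -> 'I_3}) i, half_cover e w' -> i \in F ->
    n * 2 <= dot w' a + w' i.

Section Associated.
Variables (K : fieldType) (r : nat) (e : rel 'I_r).
Hypothesis e_sym : symmetric e.
Implicit Types (w : {ffun 'I_r -> 'I_3}) (m : 'X_{1..r}) (f g : {mpoly K[r]}).
Implicit Types (F : {set 'I_r}) (P : {mpoly K[r]} -> Prop).
Local Open Scope ring_scope.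

Definition var_prime F f : Prop :=
  {in msupp f, forall m, exists2 i, i \in F & (0 < m i)%N}.

Lemma ord_ge1P w f : ord_ge w 1 f <-> (weight_subst w f)`_0 = 0.
Proof. by split=> [|f0 [|//]] //; apply. Qed.

Lemma ord_ge1_prime w : is_prime_ideal (@ord_ge K r w 1).
Proof.
split=> [||x y /ord_ge1P xy0]; first exact: ord_ge_ideal.
  by move=> /ord_ge1P/eqP; rewrite weight_subst1 coef1 oner_eq0.
have /eqP := ord_ge_coefM (ord_ge0 w x) (ord_ge0 w y).
by rewrite addn0 xy0 eq_sym mulf_eq0 => /orP[] /eqP ?; [left|right]; apply/ord_ge1P.
Qed.

Lemma dot_gt0 w m : reflect (exists2 i, (0 < w i)%N & (0 < m i)%N) (0 < dot w m)%N.
Proof.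
rewrite lt0n sum_nat_eq0; apply: (iffP forallPn) => /= [[i]|[i wi mi]].
  by rewrite muln_eq0 negb_or -!lt0n => /andP[wi mi]; exists i.
by exists i; rewrite muln_eq0 negb_or -!lt0n wi.
Qed.

Lemma ord_ge1_var_prime w F f : (forall i, (i \in F) = (0 < w i)%N) ->
  ord_ge w 1 f <-> var_prime F f.
Proof.
move=> wF; split=> [/ord_geP lf m /lf /dot_gt0[i wi mi]|vf].
  by exists i; rewrite ?wF.
by apply/ord_geP=> m /vf [i iF mi]; apply/dot_gt0; exists i; rewrite -?wF.
Qed.

Lemma prime_exp P f n : is_prime_ideal P -> P (f ^+ n) -> P f.
Proof.
move=> [_ P1 PM]; elim: n => [//|n IH]; rewrite exprS => /PM[//|]; exact: IH.
Qed.

Lemma var_prime_sub P F f : is_ideal P -> (forall i, i \in F -> P 'X_i) ->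
  var_prime F f -> P f.
Proof.
move=> [P0 PD PM] PF vf; rewrite [f]mpolyE big_seq; elim/big_ind: _ => // m /vf[i iF mi].
have le : (U_(i) <= m)%MM.
  by apply/mnm_lepP=> j; rewrite mnm1E; case: eqP => // <-.
by rewrite -mul_mpolyC -(submK le) mpolyXD mulrA; apply: PM; apply: PF.
Qed.

Lemma ord_ge_edge_pow n w f : half_cover e w ->
  integral_closure (ideal_pow (edge_ideal K e) n) f -> ord_ge w (n * 2) f.
Proof.
by move=> cw /(integral_closure_edge_pow e_sym) cf; apply/ord_geP=> m mf; apply: cf.
Qed.

Lemma edge_pow_of_ord_ge n f : (forall w, half_cover e w -> ord_ge w (n * 2) f) ->
  integral_closure (ideal_pow (edge_ideal K e) n) f.
Proof.
by move=> lf; apply/(integral_closure_edge_pow e_sym) => m w mf /lf/ord_geP; apply.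
Qed.

(** P is the intersection over all weights w of the ideals of the g for which gf
    has order at least 2n along w; a prime ideal containing a finite
    intersection contains one of its members. *)
Lemma Ass_edge_pow_weight n P f : is_prime_ideal P ->
  (forall g, P g <-> integral_closure (ideal_pow (edge_ideal K e) n) (g * f)) ->
  exists2 w, half_cover e w & forall g, ord_ge w (n * 2) (g * f) -> P g.
Proof.
move=> [_ P1 PM] PE; apply: NNPP => none.
have step w : half_cover e w -> exists2 g, ~ P g & ord_ge w (n * 2) (g * f).
  move=> cw; apply: NNPP => nw; apply: none; exists w => // g lg.
  by apply: NNPP => nPg; apply: nw; exists g.
have all_w (s : seq {ffun 'I_r -> 'I_3}) : exists2 g, ~ P g &
    forall w, w \in s -> half_cover e w -> ord_ge w (n * 2) (g * f).
  elim: s => [|w s [g nPg IH]]; first by exists 1.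
  have [cw|ncw] := boolP (half_cover e w); last first.
    exists g => // w'; rewrite inE => /predU1P[->|]; first by rewrite (negPf ncw).
    exact: IH.
  have [g' nPg' lg'] := step _ cw; exists (g' * g); first by move=> /PM[].
  move=> w'; rewrite inE => /predU1P[->|/IH IHw cw'].
    by move=> _; rewrite mulrAC mulrC; have [_ _] := @ord_ge_ideal K r w (n * 2); apply.
  by rewrite -mulrA; have [_ _] := @ord_ge_ideal K r w' (n * 2); apply; apply: IHw.
have [g nPg lg] := all_w (enum {ffun 'I_r -> 'I_3}); apply: nPg; apply/PE.
by apply: edge_pow_of_ord_ge => w cw; apply: lg => //; rewrite mem_enum.
Qed.

(** The weight w of the previous lemma determines P.  The variables in its support
    are in P because their large powers are; conversely an element with a
    monomial outside the support does not raise the order of f along w, which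
    is less than 2n. *)
Lemma Ass_edge_pow n P :
  Ass (integral_closure (ideal_pow (edge_ideal K e) n)) P <->
  exists2 F, assoc_at e n F & forall f, P f <-> var_prime F f.
Proof.
split=> [[Pp [f Pf]]|[F [w [cw wF] [a aw aF]] PF]].
  have [w cw lwP] := Ass_edge_pow_weight Pp Pf; have [Pi P1 PM] := Pp.
  have f0 : f != 0.
    apply/eqP=> f0; apply: P1; apply/Pf; rewrite f0 mulr0.
    by apply: edge_pow_of_ord_ge => w' _; have [] := @ord_ge_ideal K r w' (n * 2).
  have [v lv nv] := exists_order w f0.
  have vn : (v < n * 2)%N.
    rewrite ltnNge; apply/negP=> nlev; apply: P1; apply: lwP.
    by rewrite mul1r; apply: ord_ge_leq lv.
  pose F := [set i | (0 < w i)%N].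
  have wF i : (i \in F) = (0 < w i)%N by rewrite inE.
  have PX i : i \in F -> P 'X_i.
    rewrite wF => wi; apply: (@prime_exp _ _ (n * 2)) Pp _; apply: lwP.
    rewrite mulrC; have [_ _] := @ord_ge_ideal K r w (n * 2); apply.
    apply/ord_geP=> m; rewrite mpolyXn msuppX inE => /eqP->.
    rewrite /dot (bigD1 i) //= mulmnE mnm1E eqxx mul1n.
    by apply: leq_trans (leq_addr _ _); rewrite leq_pmull.
  have PE g : P g <-> var_prime F g.
    split=> [Pg|]; last exact: var_prime_sub.
    apply/(ord_ge1_var_prime _ wF)/ord_ge1P; apply/eqP; apply: contraT => g0.
    have := ord_ge_coefM (ord_ge0 w g) lv; rewrite add0n.
    rewrite (ord_ge_edge_pow cw (proj1 (Pf g) Pg)) // => /esym/eqP.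
    by rewrite mulf_eq0 (negPf g0) (negPf nv).
  have [m mf mv] : exists2 m, m \in msupp f & dot w m = v.
    apply: NNPP => none; move: nv; apply/negP/negPn/eqP/mpolyP => m.
    rewrite coef_weight_subst mcoeff0; case: eqP => // mv; apply: memN_msupp_eq0.
    by apply/negP=> mf; apply: none; exists m.
  exists F => //; exists w => //; exists m; first by rewrite mv.
  move=> w' i cw' /PX /Pf /(ord_ge_edge_pow cw') /ord_geP lw'.
  rewrite -(dot_mnm1 w' i) addnC -dot_mnmD; apply: lw'.
  by rewrite mulrC (perm_mem (msuppMX _ _)); apply: map_f.
have lP g : P g <-> ord_ge w 1 g.
  by split=> [/PF/(ord_ge1_var_prime _ wF)|/(ord_ge1_var_prime _ wF)/PF].
have [lp1 lp2 lp3] := ord_ge1_prime w; split.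
  split=> [|/lP//|x y /lP/lp3[]/lP ?]; [|by left|by right].
  have [l0 lD lM] := lp1.
  split; [exact/lP | by move=> x y /lP lx /lP ly; apply/lP/lD|].
  by move=> b x /lP lx; apply/lP/lM.
pose ma := [multinom a i | i < r].
have dma w' : dot w' ma = dot w' a by apply: eq_dot => i; rewrite mnmE.
exists 'X_[ma] => g; split=> [/PF vg|cg].
  apply: edge_pow_of_ord_ge => w' cw'; apply/ord_geP=> m; rewrite (perm_mem (msuppMX _ _)).
  move=> /mapP[m' /vg [i iF mi] ->]; rewrite dot_mnmD dma.
  apply: leq_trans (aF w' i cw' iF) _; rewrite leq_add2l /dot (bigD1 i) //=; nia.
apply/lP/ord_geP=> m mg; have /ord_geP/(_ (ma + m)%MM) := ord_ge_edge_pow cw cg.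
rewrite (perm_mem (msuppMX _ _)) dot_mnmD dma => /(_ (map_f _ mg)); lia.
Qed.

End Associated.

(** * Expanding vectors *)

Section Expanding.
Variables (T : finType) (e : rel T).
Hypothesis e_sym : symmetric e.
Implicit Types (w : {ffun T -> 'I_3}) (a : T -> nat) (F U S : {set T}).

Definition nbr U S : {set T} := [set y in U | [exists x in S, e x y]].

Definition indep S : bool := [forall x in S, forall y in S, ~~ e x y].

(** For a vector of total 2n - 1, the inequality w.a >= 2n for the weight that is 2
    on N(S), 0 on S and 1 elsewhere on U. *)
Definition expanding U a : Prop := forall S, S \subset U -> S != set0 -> indep S ->
  \sum_(x in S) a x < \sum_(x in nbr U S) a x.

(** On the vertices of F outside the core, a weight that vanishes outside F must
    take the value 2. *)
Definition core F : {set T} := [set x in F | [forall y, e x y ==> (y \in F)]].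

Lemma indepP S : reflect {in S &, forall x y, ~~ e x y} (indep S).
Proof.
apply: (iffP forall_inP) => [h x y xS yS|h x xS].
  by have /forall_inP := h x xS; apply.
by apply/forall_inP=> y; apply: h.
Qed.

Lemma nbrP U S y : reflect (y \in U /\ exists2 x, x \in S & e x y) (y \in nbr U S).
Proof.
rewrite inE; apply: (iffP andP) => [[yU /exists_inP]|[yU h]] //.
by split=> //; apply/exists_inP.
Qed.

Lemma coreP F x :
  reflect (x \in F /\ forall y, e x y -> y \in F) (x \in core F).
Proof.
rewrite inE; apply: (iffP andP) => [[xF /forallP h]|[xF h]]; split=> //.
  by move=> y exy; have := h y; rewrite exy.
by apply/forallP=> y; apply/implyP/h.
Qed.

Definition weight (h : T -> nat) : {ffun T -> 'I_3} := [ffun x => inord (h x)].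

Lemma weightE h : (forall x, h x < 3) -> forall x, weight h x = h x :> nat.
Proof. by move=> h3 x; rewrite ffunE inordK. Qed.

(** The least weight with support F is h0: 1 on the core, 2 on the rest of F.
    It violates the inequality, whereas its modification h vanishes on S
    and so must satisfy it; the difference of the two is the claim. *)
Lemma core_expanding n F : assoc_at e n F -> exists a, expanding (core F) a.
Proof.
move=> [w [/half_coverP cw wF] [a aw aF]]; exists a => S SU S0 /indepP iS.
pose h0 x := (x \in F) + ((x \in F) && (x \notin core F)).
pose h x := h0 x + (x \in nbr (core F) S) - (x \in S).
have coreF x : x \in core F -> x \in F by case/coreP.
have SF x : x \in S -> x \in core F by move/(subsetP SU).
have nF x : x \in nbr (core F) S -> x \in core F by case/nbrP.
have nS x : x \in nbr (core F) S -> x \notin S.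
  by move=> /nbrP[_ [y yS eyx]]; apply/negP=> xS; have := iS _ _ yS xS; rewrite eyx.
have h3 x : h x < 3.
  apply: leq_ltn_trans (leq_subr _ _) _; rewrite /h0.
  have [/nF xU|_] := boolP (x \in nbr _ _); first by rewrite xU coreF.
  by case: (x \in F); case: (x \in core F).
have cF x y : e x y -> (x \in F) || (y \in F).
  by move=> /cw; rewrite !wF -addn_gt0; lia.
have cwh : half_cover e (weight h).
  apply/half_coverP=> x y exy; rewrite !weightE //.
  suff wl u v : e u v -> u \in S -> 2 <= h v.
    have [xS|xS] := boolP (x \in S); first by have := wl _ _ exy xS; lia.
    have [yS|yS] := boolP (y \in S); first by have := wl y x; rewrite e_sym => /(_ exy yS); lia.
    have h0l u : u \notin S -> h0 u <= h u by rewrite /h => /negPf->; rewrite subn0 leq_addr.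
    apply: leq_trans (leq_add (h0l _ xS) (h0l _ yS)); rewrite /h0.
    have yx : e y x by rewrite e_sym.
    have [xU|xU] := boolP (x \in core F); have [yU|yU] := boolP (y \in core F).
    - by rewrite !coreF ?addn0 //; lia.
    - by have [-> /(_ _ exy) ->] := coreP _ _ xU.
    - by have [yF /(_ x yx) xF] := coreP _ _ yU; rewrite xF yF.
    by have := cF _ _ exy; case: (x \in F); case: (y \in F).
  move=> euv uS; have [uF /(_ _ euv) vF] := coreP _ _ (SF _ uS).
  have vS : v \notin S by apply/negP=> vS; have := iS _ _ uS vS; rewrite euv.
  rewrite /h /h0 vF (negPf vS) subn0; have [vU|//] := boolP (v \in core F).
  suff -> : v \in nbr (core F) S by [].
  by apply/nbrP; split=> //; exists u.
have [x xS] := set0Pn _ S0.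
have := aF _ x cwh (coreF _ (SF _ xS)); rewrite weightE // {2}/h /h0 xS SF // coreF ?SF //.
have -> : x \in nbr (core F) S = false by apply/negP=> /nS; rewrite xS.
rewrite /= addn0 subnn addn0 => aw'.
have w0w : \sum_y h0 y * a y <= dot w a.
  apply: leq_sum => y _; rewrite leq_mul2r; apply/orP; right; rewrite /h0.
  have [yF|//] := boolP (y \in F); have := yF; rewrite wF => wy /=.
  have [//|/coreP yU] := boolP (y \in core F); rewrite /= addn1 ltnNge; apply/negP=> wy1.
  apply: yU; split=> // z eyz; rewrite wF; have := cw _ _ eyz; lia.
suff : dot (weight h) a + \sum_(y in S) a y =
  \sum_y h0 y * a y + \sum_(y in nbr (core F) S) a y.
  lia.
rewrite !sum_indic -!big_split /=; apply: eq_bigr => y _; rewrite weightE // -!mulnDl.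
congr (_ * _); rewrite /h subnK //; have [yS|//] := boolP (y \in S).
by rewrite /h0 coreF ?SF.
Qed.

Lemma expanding_edge U a : expanding U a -> U != set0 ->
  exists x y, [/\ x \in U, y \in U & e x y].
Proof.
move=> ex /set0Pn[x xU]; apply: NNPP => none.
have exx y : y \in U -> ~~ e x y by move=> yU; apply/negP=> exy; apply: none; exists x, y.
have x0 : [set x] != set0 by apply/set0Pn; exists x; rewrite inE.
have ix : indep [set x].
  by apply/indepP=> y z; rewrite !inE => /eqP-> /eqP->; apply: exx.
have := ex [set x]; rewrite sub1set => /(_ xU x0 ix).
rewrite [X in _ < X]big1 ?ltn0 // => y /nbrP[yU [z]]; rewrite inE => /eqP-> exy.
by rewrite (negPf (exx _ yU)) in exy.
Qed.

Lemma expanding_add_edge U a k x y : x \in U -> y \in U -> e x y -> expanding U a ->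
  expanding U (fun z => a z + k * ((z == x) + (z == y))).
Proof.
move=> xU yU exy ex S SU S0 iS; rewrite !big_split /= -!big_distrr /=.
rewrite -addSn; apply: leq_add; first exact: ex.
rewrite leq_mul2l; apply/orP; right; rewrite !big_split /=.
rewrite !sum_pred1; have iSP := indepP _ iS.
have nn u v : e u v -> u \in S -> v \in U -> (v \notin S) && (v \in nbr U S).
  move=> euv uS vU; apply/andP; split; last by apply/nbrP; split=> //; exists u.
  by apply/negP=> vS; have := iSP _ _ uS vS; rewrite euv.
have := nn _ _ exy; have := nn y x; rewrite e_sym exy => /(_ isT).
case xS: (x \in S); case yS: (y \in S) => // h1 h2.
- by have := h1 isT xU.
- by have /andP[_ ->] := h2 isT yU; rewrite addn1.
by have /andP[_ ->] := h1 isT xU.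
Qed.

(** When the core is nonempty, copies of an edge bring the expanding vector to the
    total 2n - 1; it is extended by 2n outside F and by 0 on F minus the core.
    Weights that do not vanish outside F are then large enough.  The others are
    at least 1 on the core except on an independent set S, for which expansion
    makes up the loss. *)
Lemma expanding_assoc n F : 0 < n -> (forall x y, e x y -> (x \in F) || (y \in F)) ->
  (core F != set0 -> exists2 a, expanding (core F) a &
     exists2 k, k <= n & \sum_(x in core F) a x + 1 = k * 2) ->
  assoc_at e n F.
Proof.
move=> n0 cF exF.
pose h x := (x \in F) + ((x \in F) && (x \notin core F)).
have coreF x : x \in core F -> x \in F by case/coreP.
have h3 x : h x < 3 by rewrite /h; case: (x \in F); case: (x \in core F).
have cwh : half_cover e (weight h).
  apply/half_coverP=> x y exy; rewrite !weightE // /h.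
  have yx : e y x by rewrite e_sym.
  have [xU|xU] := boolP (x \in core F); have [yU|yU] := boolP (y \in core F).
  - by rewrite !coreF ?addn0 //; lia.
  - by have [-> /(_ _ exy) ->] := coreP _ _ xU.
  - by have [yF /(_ x yx) xF] := coreP _ _ yU; rewrite xF yF.
  by have := cF _ _ exy; case: (x \in F); case: (y \in F).
exists (weight h).
  by split=> // x; rewrite weightE // /h; case: (x \in F).
pose ext b x := if x \in F then b x else n * 2.
have ext_out w b x : x \notin F -> 0 < w x -> n * 2 <= dot w (ext b).
  move=> xF wx; rewrite /dot (bigD1 x) //= /ext (negPf xF).
  by apply: leq_trans (leq_addr _ _); rewrite leq_pmull.
have w2 w x : half_cover e w -> x \in F -> x \notin core F ->
    (forall y, y \notin F -> w y = 0 :> nat) -> 2 <= w x.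
  move=> /half_coverP cw xF xU wout; rewrite leqNgt; apply/negP=> wx.
  move/negP: xU; apply; apply/coreP; split=> // y exy; apply: contraT => yF.
  by have := cw _ _ exy; rewrite (wout _ yF); lia.
have out_cases w : (forall y, y \notin F -> w y = 0 :> nat) \/
    exists2 y, y \notin F & 0 < w y.
  have [/existsP[y /andP[yF wy]]|/existsPn none] :=
    boolP [exists y, (y \notin F) && (0 < w y)]; first by right; exists y.
  by left=> y yF; have := none y; rewrite yF lt0n => /negPn/eqP.
have [U0|U0] := eqVneq (core F) set0.
  have noU x : x \in core F = false by rewrite U0 inE.
  have [F0|[z zF]] := set_0Vmem F.
    exists (ext (fun=> 0)); last by move=> w x _; rewrite F0 inE.
    rewrite /dot big1 ?muln_gt0 ?n0 // => x _.
    by rewrite weightE // /h F0 inE.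
  (* With an empty core every weight vanishing outside F is 2 on F, so z
     contributes 2n - 2. *)
  exists (ext (fun x => (x == z) * n.-1)).
    rewrite /dot (bigD1 z) //= weightE // /h /ext zF noU eqxx mul1n big1 => [|x /negPf xz].
      by rewrite /=; lia.
    by rewrite weightE // /h noU; case: (x \in F); rewrite ?xz.
  move=> w x cw xF; have [wout|[y yF wy]] := out_cases w; last first.
    by apply: leq_trans (leq_addr _ _); apply: ext_out wy.
  have wx := w2 _ _ cw xF (negbT (noU x)) wout.
  have wz := w2 _ _ cw zF (negbT (noU z)) wout.
  rewrite /dot (bigD1 z) //= /ext zF eqxx mul1n; nia.
have [a exa [k kn ak]] := exF U0.
have [x0 [y0 [xU yU exy]]] := expanding_edge exa U0.
have := expanding_add_edge (n - k) xU yU exy exa; set c := fun z => _ => exc.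
have sc : \sum_(x in core F) c x + 1 = n * 2.
  by rewrite big_split /= -big_distrr /= sum_pred2 //; lia.
exists (ext (fun x => (x \in core F) * c x)).
  suff -> : dot (weight h) (ext (fun x => (x \in core F) * c x)) = \sum_(x in core F) c x.
    by lia.
  rewrite sum_indic; apply: eq_bigr => x _; rewrite weightE // /h /ext.
  have := coreF x; case: (x \in core F) => [->//|_]; first by rewrite mul1n.
  by case: (x \in F); rewrite ?muln0.
move=> w i cw iF; have [wout|[y yF wy]] := out_cases w; last first.
  by apply: leq_trans (leq_addr _ _); apply: ext_out wy.
have dotE : dot w (ext (fun x => (x \in core F) * c x)) = \sum_(x in core F) w x * c x.
  rewrite sum_indic; apply: eq_bigr => x _; rewrite /ext.
  have [xF|xF] := boolP (x \in F); first by rewrite mulnCA.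
  by rewrite wout // !mul0n muln0.
rewrite dotE; pose S := [set x in core F | w x == 0 :> nat].
have [S0|S0] := eqVneq S set0.
  have wU x : x \in core F -> 0 < w x.
    move=> xU'; rewrite lt0n; apply/negP=> wx; have : x \in S by rewrite inE xU'.
    by rewrite S0 inE.
  have wi : 0 < w i.
    have [/wU //|iU] := boolP (i \in core F).
    by apply: leq_trans (w2 _ _ cw iF iU wout).
  have : \sum_(x in core F) c x <= \sum_(x in core F) w x * c x.
    by apply: leq_sum => x /wU wx; rewrite leq_pmull.
  lia.
have SU : S \subset core F by apply/subsetP=> x; rewrite inE => /andP[].
have Sw x : x \in S -> w x = 0 :> nat by rewrite inE => /andP[_ /eqP].
have iS : indep S.
  apply/indepP=> x y /Sw wx /Sw wy; apply/negP=> /(half_coverP _ _ cw).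
  by rewrite wx wy.
have := exc _ SU S0 iS.
have nU : nbr (core F) S \subset core F by apply/subsetP=> x /nbrP[].
have : \sum_(x in core F) c x + \sum_(x in nbr (core F) S) c x
       <= \sum_(x in core F) w x * c x + \sum_(x in S) c x.
  rewrite !sum_indic -!big_split /=.
  apply: leq_sum => x _; have := subsetP SU x; have := subsetP nU x.
  have [xN|xN] := boolP (x \in nbr _ _).
    have := xN => /nbrP[xU' [y yS eyx]] _ _; rewrite xU'.
    have := half_coverP _ _ cw _ _ eyx; rewrite (Sw _ yS) add0n => wx.
    have -> : x \in S = false by apply/negP=> /Sw wx0; rewrite wx0 in wx.
    by rewrite !mul1n mul0n addn0 addnn -mul2n leq_mul2r wx orbT.
  move=> _; have [xS _|xS _] := boolP (x \in S); first by rewrite !mul1n mul0n addn0;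
    case: (x \in core F); rewrite ?mul1n ?mul0n ?leq_addl.
  have [xU'|xU'] := boolP (x \in core F) => //.
  by move: xS; rewrite inE xU' -lt0n => wx; rewrite !mul1n !mul0n !addn0 leq_pmull.
by move: sc; clear; lia.
Qed.

End Expanding.

(** * Odd cycles *)

(** Cutting an odd closed walk at a repeated vertex gives two shorter closed
    walks, one of which is odd. *)
Lemma odd_closed_ucycle (T : finType) (r : rel T) (c : seq T) :
  cycle r c -> odd (size c) ->
  exists c', [/\ ucycle r c', odd (size c') & {subset c' <= c}].
Proof.
have [n] := ubnP (size c); elim: n c => // n IH c sc cyc oc.
have [uc|nuc] := boolP (uniq c); first by exists c; split; rewrite /ucycle ?cyc.
have [x [s1 [s2 [i cE]]]] : exists x s1 s2 i, rot i c = x :: s1 ++ x :: s2.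
  case: c {sc cyc oc} nuc => [//|x0 c] /(uniqPn x0) [i [j [ij js nij]]].
  set c0 := x0 :: c in js nij *.
  have: nth x0 (drop i.+1 c0) (j - i.+1) \in drop i.+1 c0.
    by apply: mem_nth; rewrite size_drop ltn_sub2r //; apply: leq_ltn_trans js.
  rewrite nth_drop subnKC // -nij => /splitPr h.
  case: h (drop_nth x0 (ltn_trans ij js)) => s1 s2 dE.
  by exists (nth x0 c0 i), s1, (s2 ++ take i c0), i; rewrite /rot dE /= -catA.
have sE : size c = size s1 + size s2 + 2.
  by rewrite -(size_rot i c) cE /= size_cat /=; lia.
have subc s : {subset s <= x :: s1 ++ x :: s2} -> {subset s <= c}.
  by move=> h y /h; rewrite -cE mem_rot.
move: cyc; rewrite -(rot_cycle i) cE /= rcons_cat cat_path /=.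
move=> /and3P[p1 l1 p2].
have [o1|o1] := boolP (odd (size s2)).
  have [|||c' [uc' oc' sc']] := IH (x :: s1); rewrite /= ?rcons_path ?p1 //; try lia.
  exists c'; split=> // y /sc' ys; apply: subc ys => z.
  by rewrite !inE mem_cat => /orP[->|->]; rewrite ?orbT.
have [|||c' [uc' oc' sc']] := IH (x :: s2); rewrite /= ?p2 //; try lia.
exists c'; split=> // y /sc' ys; apply: subc ys => z.
by rewrite !inE mem_cat inE => /orP[->|->]; rewrite ?orbT.
Qed.

Section OddCycles.
Variables (T : finType) (e : rel T).
Hypotheses (e_sym : symmetric e) (e_irr : irreflexive e).
Implicit Types (a : T -> nat) (U S : {set T}).

Lemma induced_sym U : symmetric (induced e U).
Proof. by move=> x y; rewrite /induced /= e_sym andbCA. Qed.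

Lemma connect_induced_sym U : connect_sym (induced e U).
Proof. exact/sym_connect_sym/induced_sym. Qed.

Lemma connect_induced_mem U x y : connect (induced e U) x y -> x \in U -> y \in U.
Proof.
move=> /connectP[p xp ->] xU; case/lastP: p xp => [//|p z].
by rewrite rcons_path last_rcons => /andP[_ /and3P[]].
Qed.

(** X and Y are the vertices reached from x by walks of even and of odd length.
    If they were disjoint, both would be independent with N(X) in Y and N(Y) in
    X, and the sum of a over X would be smaller than itself. *)
Lemma expanding_odd_cycle U a x : expanding e U a -> x \in U ->
  exists c, [/\ ucycle (induced e U) c, odd (size c)
              & {in c, forall y, connect (induced e U) x y}].
Proof.
move=> ex xU.
(* The second component of a vertex of e2 is the parity of the walk. *)
pose e2 := [rel p q : T * bool | induced e U p.1 q.1 && (p.2 != q.2)].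
have e2_sym : connect_sym e2.
  by apply: sym_connect_sym => p q; rewrite /= -!/(induced e U _ _) induced_sym eq_sym.
have e2_fst p q : connect e2 p q -> connect (induced e U) p.1 q.1.
  move=> /connectP[s ps ->]; elim: s p ps => [|z s IH] p /=; first by rewrite connect0.
  move=> /andP[/andP[pz _] /IH]; apply: connect_trans; exact: connect1.
pose X := [set y | connect e2 (x, false) (y, false)].
pose Y := [set y | connect e2 (x, false) (y, true)].
have inU b y : connect e2 (x, false) (y, b) -> y \in U.
  by move=> /e2_fst /connect_induced_mem; apply.
have [dis|[y /setIP[yX yY]]] := set_0Vmem (X :&: Y); last first.
  rewrite !inE in yX yY.
  have : connect e2 (y, false) (y, true).
    by apply: connect_trans yY; rewrite e2_sym.
  move=> /connectP[s ps lst].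
  have walk p : path e2 p s -> path (induced e U) p.1 (map fst s) /\
      (last p s).2 = p.2 (+) odd (size s).
    elim: s p {ps lst} => [|q s IH] p /=; first by rewrite addbF.
    move=> /andP[/andP[-> pq] /IH[-> ->]]; split=> //.
    by move: pq; case: p.2; case: q.2; case: (odd _).
  have [ps' os] := walk _ ps; rewrite -lst /= in os.
  have lsy : last y (map fst s) = y.
    by rewrite -[X in last X](erefl (y, false).1) last_map -lst.
  have cyc : cycle (induced e U) (map fst s).
    move: ps' lsy; case/lastP: (map fst s) => [//|s' z]; rewrite last_rcons => ps' zy.
    by rewrite -rot1_cons rot_cycle /= zy; rewrite zy in ps'.
  have [|c [uc oc sc]] := odd_closed_ucycle cyc; first by rewrite size_map -os.
  exists c; split=> // z /sc zs; apply: connect_trans (e2_fst _ _ yX) _.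
  by apply: (path_connect ps'); rewrite inE zs orbT.
have XU : X \subset U by apply/subsetP=> y; rewrite inE => /inU.
have YU : Y \subset U by apply/subsetP=> y; rewrite inE => /inU.
have step b y z : connect e2 (x, false) (y, b) -> z \in U -> e y z ->
    connect e2 (x, false) (z, ~~ b).
  move=> cy zU eyz; apply: (connect_trans cy); apply: connect1.
  by rewrite /= /induced /= (inU _ _ cy) zU eyz; case: (b).
have XY y : y \in X -> y \notin Y.
  by move=> yX; apply/negP=> yY; have := in_set0 y; rewrite -dis inE yX yY.
have nX : nbr e U X \subset Y.
  apply/subsetP=> z /nbrP[zU [y yX eyz]]; rewrite inE.
  by apply: (step false y) => //; rewrite inE in yX.
have nY : nbr e U Y \subset X.
  apply/subsetP=> z /nbrP[zU [y yX eyz]]; rewrite inE.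
  by apply: (step true y) => //; rewrite inE in yX.
have iX : indep e X.
  apply/indepP=> y z yX zX; apply/negP=> eyz; have := XY _ zX; apply/negP/negPn.
  by apply: (subsetP nX); apply/nbrP; split; [exact: (subsetP XU)|exists y].
have iY : indep e Y.
  apply/indepP=> y z yY zY; apply/negP=> eyz; have /XY : z \in X; last by rewrite zY.
  by apply: (subsetP nY); apply/nbrP; split; [exact: (subsetP YU)|exists y].
have X0 : X != set0 by apply/set0Pn; exists x; rewrite inE connect0.
have exX := ex _ XU X0 iX.
have Y0 : Y != set0.
  apply/set0Pn; have [n0|[y /(subsetP nX)]] := set_0Vmem (nbr e U X); last by exists y.
  by move: exX; rewrite n0 big_set0.
have exY := ex _ YU Y0 iY.
have sub_le (A B : {set T}) : A \subset B -> \sum_(z in A) a z <= \sum_(z in B) a z.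
  move=> AB; rewrite (big_setID A (A := B)) /= (setIidPr AB); exact: leq_addr.
have := sub_le _ _ nX; have := sub_le _ _ nY; lia.
Qed.

(** Both the successors and the predecessors along C of the vertices of S lie in
    N(S).  If N(S) had no further vertex on C, then the successor of the
    successor would preserve S; as C is odd, it would make S contain two
    adjacent vertices. *)
Lemma odd_cycle_expanding U c S : ucycle (induced e U) c -> odd (size c) ->
  indep e S -> let C := [set x in c] in
  #|C :&: S| <= #|C :&: nbr e U S| /\
  (C :&: (S :|: nbr e U S) != set0 -> #|C :&: S| < #|C :&: nbr e U S|).
Proof.
move=> /andP[cyc uc] oc /indepP iS C.
have nxt_inj : injective (next c) := can_inj (prev_next uc).
have prv_inj : injective (prev c) := can_inj (next_prev uc).
have nxt_edge x : x \in c -> induced e U x (next c x) by apply: next_cycle.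
have prv_edge x : x \in c -> induced e U (prev c x) x by apply: prev_cycle.
have nxtN : next c @: (C :&: S) \subset C :&: nbr e U S.
  apply/subsetP=> y /imsetP[x /setIP[]]; rewrite inE => xc xS ->.
  rewrite !inE mem_next xc; have /and3P[_ -> exn] := nxt_edge _ xc.
  by apply/exists_inP; exists x.
have prvN : prev c @: (C :&: S) \subset C :&: nbr e U S.
  apply/subsetP=> y /imsetP[x /setIP[]]; rewrite inE => xc xS ->.
  rewrite !inE mem_prev xc; have /and3P[-> _ exn] := prv_edge _ xc.
  by apply/exists_inP; exists x; rewrite // e_sym.
have le : #|C :&: S| <= #|C :&: nbr e U S|.
  by rewrite -(card_imset _ nxt_inj) subset_leq_card.
split=> // touch; rewrite ltn_neqAle le andbT; apply/eqP=> eqN.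
have [A0|[x xA]] := set_0Vmem (C :&: S).
  move: touch; rewrite setIUr A0 set0U; apply/negP/negPn.
  by rewrite -cards_eq0 -eqN A0 cards0.
have nE : next c @: (C :&: S) = C :&: nbr e U S.
  by apply/eqP; rewrite eqEcard nxtN card_imset // eqN leqnn.
have pE : prev c @: (C :&: S) = C :&: nbr e U S.
  by apply/eqP; rewrite eqEcard prvN card_imset // eqN leqnn.
have next2 y : y \in C :&: S -> next c (next c y) \in C :&: S.
  move=> yA; have : next c y \in prev c @: (C :&: S) by rewrite pE -nE imset_f.
  by case/imsetP=> z zA ->; rewrite next_prev.
have iter2 k y : y \in C :&: S -> iter k.*2 (next c) y \in C :&: S.
  by move=> yA; elim: k => [//|k IH]; rewrite doubleS !iterS next2.
have xc : x \in c by case/setIP: xA; rewrite inE.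
have : next c x \in C :&: S.
  have -> : next c x = iter (uphalf (size c)).*2 (next c) x.
    rewrite odd_uphalfK // iterS -[in iter (size c)](order_cycle (cycle_next uc) uc xc).
    by rewrite iter_order.
  exact: iter2.
case/setIP=> _ nxS; have [_ xS] := setIP xA.
by have /and3P[_ _] := nxt_edge _ xc; apply/negP/iS.
Qed.

End OddCycles.

(** * Building an expanding vector from odd cycles *)

Section Construction.
Variables (T : finType) (e : rel T).
Hypotheses (e_sym : symmetric e) (e_irr : irreflexive e).
Implicit Types (a : T -> nat) (U S D L : {set T}).

(** An intermediate stage of the construction: strictness is required only when S
    or its neighbourhood meets D. *)
Definition expanding_near U D a : Prop := forall S, S \subset U -> indep e S ->
  \sum_(x in S) a x <= \sum_(x in nbr e U S) a x /\
  (D :&: (S :|: nbr e U S) != set0 ->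
   \sum_(x in S) a x < \sum_(x in nbr e U S) a x).

(** Whenever S or N(S) meets u |: D but not D, the vertex u is in N(S) and v is not
    in S, so the new edge makes the inequality strict. *)
Lemma expanding_near_grow U D a u v : u \in U -> v \in D -> D \subset U -> e u v ->
  expanding_near U D a ->
  expanding_near U (u |: D) (fun z => a z + ((z == u) + (z == v))).
Proof.
move=> uU vD /subsetP DU euv nr S SU iS; have [le lt] := nr S SU iS.
rewrite !big_split /= !sum_pred1; have iSP := indepP _ _ iS.
have nn x y : e x y -> x \in S -> y \in U -> (y \notin S) && (y \in nbr e U S).
  move=> exy xS yU; apply/andP; split; last by apply/nbrP; split=> //; exists x.
  by apply/negP=> yS; have := iSP _ _ xS yS; rewrite exy.
have nuv := nn _ _ euv; have nvu := nn v u; rewrite e_sym euv in nvu.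
have vtouch : (v \in S) || (v \in nbr e U S) -> D :&: (S :|: nbr e U S) != set0.
  by move=> h; apply/set0Pn; exists v; rewrite !inE vD; rewrite !inE in h.
move: (\sum_(x in S) a x) (\sum_(x in nbr e U S) a x) le lt => A B le lt.
case uS: (u \in S).
  have /andP[/negPf vS vN] := nuv uS (DU _ vD).
  have := lt (vtouch _); rewrite vN vS orbT => /(_ isT) AB.
  by clear -AB; split; case: (u \in nbr e U S) => /=; lia.
case vS: (v \in S).
  have /andP[_ uN] := nvu isT vS uU.
  have := lt (vtouch _); rewrite uN vS => /(_ isT) AB.
  by clear -AB; split; case: (v \in nbr e U S) => /=; lia.
split; first by clear -le; lia.
move=> /set0Pn[x]; rewrite in_setI in_setU1 => /andP[/predU1P[->|xD] xSN].
  by move: xSN; rewrite in_setU uS /= => ->; clear -le; lia.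
have /lt AB : D :&: (S :|: nbr e U S) != set0; last by clear -AB; lia.
by apply/set0Pn; exists x; rewrite in_setI xD.
Qed.

(** D is grown inside L as long as possible.  At the end, a vertex outside D but
    adjacent to D is not in L and has no other neighbour; therefore D together
    with its neighbours is closed under adjacency and covers U. *)
Lemma expanding_near_saturate U L D a :
  L \subset U -> D \subset L ->
  (forall u v v', u \in U -> u \notin L -> e u v -> e u v' -> v = v') ->
  (forall x, x \in U -> exists2 y, y \in D & connect (induced e U) y x) ->
  expanding_near U D a ->
  exists2 b, expanding e U b &
    exists2 k, k + #|D| <= #|L| & \sum_(x in U) b x = \sum_(x in U) a x + k * 2.
Proof.
move=> /subsetP LU; have [n] := ubnP #|L :\: D|; elim: n D a => // n IH D a szn.
move=> DL leaf conn nr; have DU : D \subset U.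
  by apply/subsetP=> x /(subsetP DL); apply: LU.
have [[u [v [uL uD vD euv]]]|noext] :=
  classic (exists u v, [/\ u \in L, u \notin D, v \in D & e u v]).
  have cD : #|u |: D| = #|D|.+1 by rewrite cardsU1 uD.
  have [||x|b exb [k kL sb]] := IH (u |: D) _ _ _ leaf _
      (expanding_near_grow (LU _ uL) vD DU euv nr).
  - rewrite ltnS in szn; apply: leq_trans szn; apply: proper_card; apply/properP; split.
      by apply: setDS; apply: subsetUr.
    by exists u; rewrite !inE ?eqxx // uD.
  - by rewrite subUset sub1set uL.
  - by move=> /conn[y yD yx]; exists y => //; rewrite inE yD orbT.
  exists b => //; exists k.+1; first by rewrite cD in kL; lia.
  by rewrite sb big_split /= sum_pred2 ?(LU _ uL) ?(subsetP DU) //; lia.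
exists a; last by exists 0; rewrite ?subset_leq_card ?addn0.
move=> S SU /set0Pn[x xS] iS; have [_] := nr S SU iS; apply.
pose Z := [set z in U | (z \in D) || [exists y in D, e z y]].
have Zclosed z z' : z \in Z -> induced e U z z' -> z' \in Z.
  move=> zZ /and3P[zU z'U ezz']; rewrite inE z'U /=; move: zZ; rewrite inE zU /=.
  have [zD _|zD /exists_inP[y yD ezy]] := boolP (z \in D).
    by apply/orP; right; apply/exists_inP; exists z; rewrite // e_sym.
  have zL : z \notin L.
    by apply/negP=> zL; apply: noext; exists z, y.
  by rewrite (leaf _ _ _ zU zL ezz' ezy) yD.
have xU := subsetP SU _ xS; have [y yD /connectP[p yp xE]] := conn _ xU.
have : x \in Z.
  have : y \in Z by rewrite inE yD (subsetP DU).
  rewrite {xS xU}xE; elim: p y yp {yD} => [//|z p IHp] y /= /andP[yz zp] yZ.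
  by apply: IHp => //; apply: Zclosed yz.
rewrite inE xU /= => /orP[xD|/exists_inP[z zD exz]]; apply/set0Pn.
  by exists x; rewrite !inE xD xS.
exists z; rewrite in_setI zD in_setU; apply/orP; right; apply/nbrP.
by split; [exact: (subsetP DU)|exists x].
Qed.

Definition nonleaf : {set T} := [set x | degree e setT x != 1].

Lemma odd_cycle_nonleaf U c : ucycle (induced e U) c -> odd (size c) ->
  {subset c <= U :&: nonleaf}.
Proof.
move=> /andP[cyc uc] oc x xc; rewrite !inE.
have /and3P[xU nU exn] := next_cycle cyc xc; have /and3P[_ _ epx] := prev_cycle cyc xc.
rewrite xU /=; apply/negP=> /cards1P[y yE].
have ny : next c x = y by apply/set1P; rewrite -yE inE /induced /= !inE.
have py : prev c x = y by apply/set1P; rewrite -yE inE /induced /= !inE e_sym.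
have nn : next c (next c x) = x by rewrite ny -py next_prev.
have it k : iter k.*2 (next c) x = x by elim: k => [//|k IH]; rewrite doubleS !iterS IH.
have := it (uphalf (size c)); rewrite odd_uphalfK // iterS.
rewrite -[in iter (size c)](order_cycle (cycle_next uc) uc xc).
rewrite (iter_order (can_inj (prev_next uc))) => nx.
by rewrite nx e_irr in exn.
Qed.

Definition component_roots U : {set T} := [set x in U | fingraph.root (induced e U) x == x].

(** One cycle for each component of G[U], the component being represented by its
    root; the cycles whose root is not in R' are counted twice. *)
Lemma expanding_from_cycles U (c : T -> seq T) (R' : {set T}) :
  (forall x, x \in U -> [/\ ucycle (induced e U) (c x), odd (size (c x))
     & {in c x, forall y, connect (induced e U) x y}]) ->
  R' \subset component_roots U ->
  exists2 b, expanding e U b &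
    exists2 m, m <= #|U :&: nonleaf| &
      \sum_(x in U) b x + \sum_(x in R') size (c x) = m * 2.
Proof.
move=> cP /subsetP R'R; set R := component_roots U in R'R *.
have RU x : x \in R -> x \in U by rewrite inE => /andP[].
pose C x := [set z in c x].
have cardC x : x \in R -> #|C x| = size (c x).
  by move=> /RU /cP[/andP[_ /card_uniqP <-] _ _]; rewrite cardsE.
(* k x is the multiplicity of the cycle at x. *)
pose k x := 1 + (x \notin R').
pose a z := \sum_(x in R) k x * (z \in c x).
pose D := \bigcup_(x in R) C x.
have sumS S : \sum_(z in S) a z = \sum_(x in R) k x * #|C x :&: S|.
  rewrite exchange_big /=; apply: eq_bigr => x _; rewrite -big_distrr /=; congr (_ * _).
  rewrite -sum1_card [RHS](eq_bigl (fun z => (z \in S) && (z \in c x))).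
    by rewrite [RHS]big_mkcondr.
  by move=> z; rewrite !inE andbC.
have nr : expanding_near U D a.
  move=> S SU iS; rewrite !sumS.
  have each x : x \in R -> _ := fun xR =>
    let: And3 u o _ := cP x (RU x xR) in odd_cycle_expanding e_sym u o iS.
  have le x : x \in R -> k x * #|C x :&: S| <= k x * #|C x :&: nbr e U S|.
    by move=> /each[h _]; rewrite leq_mul2l h orbT.
  split; first exact: leq_sum.
  move=> /set0Pn[z /setIP[/bigcupP[x xR zC] zS]].
  rewrite (bigD1 x) //= [X in _ < X](bigD1 x) //= -addSn leq_add //.
    have [_ lt] := each _ xR; rewrite ltn_pmul2l ?lt //.
    by apply/set0Pn; exists z; rewrite in_setI zC.
  by apply: leq_sum => y /andP[/le].
have CU x : x \in R -> C x \subset U :&: nonleaf.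
  move=> /RU /cP[u o _]; apply/subsetP=> z; rewrite in_set.
  exact: odd_cycle_nonleaf u o _.
have [||u v v'|x xU|b exb [j jL sb]] :=
  expanding_near_saturate (L := U :&: nonleaf) _ _ _ _ nr.
- exact: subsetIl.
- by apply/bigcupsP.
- rewrite !inE => -> /=; rewrite negbK => /cards1P[y yE] euv euv'.
  have /set1P-> : v \in [set y] by rewrite -yE inE /induced /= !inE.
  by have /set1P-> : v' \in [set y] by rewrite -yE inE /induced /= !inE.
- pose x0 := fingraph.root (induced e U) x.
  have cx : connect (induced e U) x x0 := connect_root _ x.
  have x0U := connect_induced_mem cx xU.
  have x0R : x0 \in R by rewrite inE x0U /= root_root //; apply: connect_induced_sym.
  have [/andP[_ _] o0 con] := cP _ x0U.
  case cE: (c x0) => [|y s]; first by rewrite cE in o0.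
  have yc : y \in c x0 by rewrite cE mem_head.
  exists y; first by apply/bigcupP; exists x0; rewrite // inE.
  by rewrite (connect_induced_sym e_sym) (connect_trans cx) // con.
have DE : \sum_(x in R) size (c x) <= #|D|.
  have -> : \sum_(x in R) size (c x) = \sum_z \sum_(x in R) (z \in c x).
    rewrite exchange_big /=; apply: eq_bigr => x xR; rewrite -cardC // -sum1_card.
    by rewrite [LHS]big_mkcond; apply: eq_bigr => z _; rewrite inE; case: (z \in _).
  rewrite -sum1_card [X in _ <= X]big_mkcond; apply: leq_sum => z _.
  have [zD|zD] := boolP (z \in D); last first.
    rewrite big1 // => x xR; apply/eqP; rewrite eqb0; apply: contra zD => zx.
    by apply/bigcupP; exists x; rewrite // inE.
  have /bigcupP[x xR _] := zD.
  pose x0 := fingraph.root (induced e U) z.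
  have xz y : y \in R -> z \in c y -> y = x0.
    move=> yR zy; have [_ _ /(_ _ zy) yz] := cP _ (RU _ yR).
    move: yR; rewrite inE => /andP[_ /eqP<-]; apply/eqP.
    by rewrite /x0 root_connect //; apply: connect_induced_sym.
  apply: (@leq_trans (\sum_(y in R) (y == x0))); last by rewrite sum_pred1 leq_b1.
  by apply: leq_sum => y yR; case zy: (z \in c y) => //; rewrite (xz y) ?eqxx.
exists b => //; exists (j + \sum_(x in R) size (c x)); first by lia.
rewrite sb sumS.
have -> : \sum_(x in R) k x * #|C x :&: U| = \sum_(x in R) k x * size (c x).
  apply: eq_bigr => x xR; rewrite (setIidPl _) ?cardC //.
  by apply: subset_trans (CU _ xR) (subsetIl _ _).
suff : \sum_(x in R) k x * size (c x) + \sum_(x in R') size (c x)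
       = 2 * \sum_(x in R) size (c x) by clear; lia.
have -> : \sum_(x in R') size (c x) = \sum_(x in R) (x \in R') * size (c x).
  rewrite sum_indic [RHS]sum_indic; apply: eq_bigr => x _.
  by have := R'R x; case: (x \in R') => [->//|_]; rewrite ?mul1n // muln0.
rewrite -big_split big_distrr /=; apply: eq_bigr => x _; rewrite -mulnDl /k.
by case: (x \in R').
Qed.

End Construction.

(** * Odd girths and the bound *)

Section Girth.
Variables (T : finType) (e : rel T).
Hypotheses (e_sym : symmetric e) (e_irr : irreflexive e).
Implicit Types (A C U : {set T}) (c : seq T).

Lemma sub_cycle A c x : cycle (induced e A) c -> x \in c -> x \in A.
Proof. by move=> cyc xc; have /and3P[] := next_cycle cyc xc. Qed.

Lemma odd_girth_le A c : ucycle (induced e A) c -> odd (size c) ->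
  odd_girth e A <= size c.
Proof.
move=> uc oc; rewrite leqNgt; apply/negP=> /(before_find 0).
have /andP[cyc /card_uniqP <-] := uc.
have le : #|c| < #|A|.+1.
  by rewrite ltnS; apply/subset_leq_card/subsetP => x; apply: sub_cycle.
rewrite nth_iota // add0n; have /andP[_ /card_uniqP ->] := uc; rewrite oc /=.
by move/existsP=> []; exists (in_tuple c).
Qed.

Lemma odd_girth_cycle A c : ucycle (induced e A) c -> odd (size c) ->
  odd (odd_girth e A) /\
  exists2 c', ucycle (induced e A) c' & size c' = odd_girth e A.
Proof.
move=> uc oc; pose P m := odd m && has_cycle e A m.
have hasP : has P (iota 0 #|A|.+1).
  apply/hasP; exists (size c); last first.
    by rewrite /P oc; apply/existsP; exists (in_tuple c).
  have /andP[cyc /card_uniqP <-] := uc.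
  rewrite mem_iota /= add0n ltnS; apply/subset_leq_card/subsetP => x; exact: sub_cycle.
have := nth_find 0 hasP; rewrite nth_iota; last by rewrite has_find size_iota in hasP.
rewrite add0n => /andP[og /existsP[c' uc']]; split=> //.
by exists c'; rewrite ?size_tuple.
Qed.

Lemma bipartite_no_odd_cycle A c : bipartite e A -> cycle (induced e A) c ->
  ~~ odd (size c).
Proof.
move=> /existsP[B /forallP alt]; case: c => [//|x p] /= cyc.
have walk q y : path (induced e A) y q -> (last y q \in B) = (y \in B) (+) odd (size q).
  elim: q y => [|z q IH] y /=; first by rewrite addbF.
  move=> /andP[yz /IH ->]; have /forallP/(_ z)/implyP/(_ yz) := alt y.
  by case: (y \in B); case: (z \in B); case: (odd _).
have := walk _ _ cyc; rewrite last_rcons size_rcons /=.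
by case: (x \in B); case: (odd _).
Qed.

Lemma leaf_edges_le A : #|leaf_edges e A| <= #|[set x in A | degree e A x == 1]|.
Proof.
pose g x := x |: [set y | induced e A x y].
apply: leq_trans (leq_imset_card g _); apply/subset_leq_card/subsetP => E.
rewrite inE => /andP[]; rewrite inE => /existsP[x /existsP[y /andP[xy /eqP->]]].
move=> /exists_inP[z zE dz].
have leafE u v : induced e A u v -> degree e A u == 1 ->
    [set u; v] \in [set g x | x in [set x in A | degree e A x == 1]].
  move=> uv du; apply/imsetP; exists u; first by rewrite inE du; case/and3P: uv => ->.
  rewrite /g; congr (_ |: _); have /cards1P[t tE] := du; rewrite tE; congr [set _].
  by apply/set1P; rewrite -tE inE.
move: zE; rewrite !inE => /orP[] /eqP zx; subst z; first exact: leafE.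
by rewrite setUC; apply: leafE; rewrite // induced_sym.
Qed.

Definition edge_closed A : Prop := forall x y, x \in A -> e x y -> y \in A.

Lemma connect_closed A x y : edge_closed A -> x \in A ->
  connect (induced e A) x y = connect e x y.
Proof.
move=> cA xA; apply/idP/idP.
  by apply: connect_sub => u v /and3P[_ _ uv]; apply: connect1.
move=> /connectP[p xp ->]; elim: p x xA xp => [|z p IH] x xA /=; first by rewrite connect0.
move=> /andP[xz zp]; have zA := cA _ _ xA xz; apply: connect_trans (IH _ zA zp).
by apply: connect1; rewrite /induced /= xA zA.
Qed.

Lemma degree_closed A x : edge_closed A -> x \in A -> degree e A x = degree e setT x.
Proof.
move=> cA xA; apply: eq_card => y; rewrite !inE /induced /= !inE xA /=.
by have := cA x y xA; case: (e x y) => [->|]; rewrite ?andbF.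
Qed.

Lemma nonleaf_le C : edge_closed C -> #|C :&: nonleaf e| <= #|C| - #|leaf_edges e C|.
Proof.
move=> cC; apply: leq_trans (leq_sub2l _ (leaf_edges_le C)).
rewrite -[#|C|](cardsID (nonleaf e)).
suff -> : C :\: nonleaf e = [set x in C | degree e C x == 1] by rewrite addnK.
apply/setP=> x; rewrite !inE; have [xC|] := boolP (x \in C); last by rewrite andbF.
by rewrite degree_closed // negbK andbT.
Qed.

Definition component_of x : {set T} := [set y | connect e x y].

Lemma component_of_closed x : edge_closed (component_of x).
Proof. by move=> y z; rewrite !inE => xy yz; apply: connect_trans xy (connect1 yz). Qed.

Lemma component_of_eq x y : y \in component_of x -> component_of y = component_of x.
Proof.
rewrite inE => xy; apply/setP=> z; rewrite !inE.
by rewrite (same_connect (sym_connect_sym e_sym) xy).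
Qed.

Lemma mem_component_of x : x \in component_of x. Proof. by rewrite inE connect0. Qed.

Lemma component_of_components x : component_of x \in components e setT.
Proof.
apply/imsetP; exists x; rewrite ?inE //; apply/setP=> y; rewrite !inE.
by rewrite connect_closed // ?inE // => ? ? _ _; rewrite inE.
Qed.

Lemma components_cover U : components e (cover (component_of @: U)) = component_of @: U.
Proof.
set A := cover _.
have AP x : x \in A -> exists2 u, u \in U & x \in component_of u.
  by move=> /bigcupP[_ /imsetP[u uU ->] xu]; exists u.
have cA : edge_closed A.
  move=> x y /AP[u uU xu] exy; apply/bigcupP; exists (component_of u); first exact: imset_f.
  exact: component_of_closed exy.
have blockE x : x \in A -> [set y in A | connect (induced e A) x y] = component_of x.
  move=> xA; apply/setP=> y; rewrite !inE connect_closed //.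
  by apply: andb_idl; rewrite -(connect_closed _ cA xA) => /connect_induced_mem; apply.
apply/setP=> C; apply/imsetP/imsetP => [[x xA ->]|[u uU ->]].
  by have [u uU xu] := AP _ xA; exists u; rewrite // blockE // (component_of_eq xu).
have uA : u \in A by apply/bigcupP; exists (component_of u); rewrite ?mem_component_of ?imset_f.
by exists u; rewrite // blockE.
Qed.

Lemma connect_induced_sub A x y : connect (induced e A) x y -> connect e x y.
Proof. by apply: connect_sub => u v /and3P[_ _ uv]; apply: connect1. Qed.

Lemma ucycle_sub A C c : ucycle (induced e A) c -> {subset c <= C} ->
  ucycle (induced e C) c.
Proof.
move=> /andP[cyc uc] cC; rewrite /ucycle uc andbT.
apply: cycle_from_next => // x xc; have /and3P[_ _ exn] := next_cycle cyc xc.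
by rewrite /induced /= !cC // mem_next.
Qed.

Lemma ucycle_in_component A c x : ucycle (induced e A) c -> x \in c ->
  ucycle (induced e (component_of x)) c.
Proof.
move=> uc xc; apply: (ucycle_sub uc) => y yc; rewrite inE.
have /andP[cyc _] := uc; case/splitPr: xc cyc yc {uc} => p q.
rewrite -(rot_cycle (size p)) rot_size_cat /= => pth yc.
apply: (@connect_induced_sub A); apply: (path_connect pth).
move: yc; rewrite !inE mem_rcons inE !mem_cat inE.
by case: (y \in p); case: (y == x); case: (y \in q).
Qed.

Lemma odd_sum_odd (I : finType) (P : {set I}) (F : I -> nat) :
  (forall i, i \in P -> odd (F i)) -> odd (\sum_(i in P) F i) = odd #|P|.
Proof.
move=> oF; rewrite -sum1_card.
by elim/big_rec2: _ => // i m n iP IH; rewrite !oddD IH oF.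
Qed.

Lemma sum_girth_le (R' : {set T}) (c : T -> seq T) :
  (forall x, x \in R' -> odd_girth e (component_of x) <= size (c x)) ->
  \sum_(C in component_of @: R') odd_girth e C <= \sum_(x in R') size (c x).
Proof.
move=> h; rewrite (partition_big component_of (fun C => C \in component_of @: R')) /=; last first.
  by move=> x xR; apply: imset_f.
apply: leq_sum => _ /imsetP[x xR ->].
by rewrite (bigD1 x) /= ?xR ?eqxx //; apply: leq_trans (h _ xR) (leq_addr _ _).
Qed.

Lemma card_nonleaf_le U :
  #|U :&: nonleaf e| <= \sum_(C in component_of @: U) #|C :&: nonleaf e|.
Proof.
rewrite -sum1_card (partition_big component_of (fun C => C \in component_of @: U)) /=; last first.
  by move=> x; rewrite inE => /andP[xU _]; apply: imset_f.
apply: leq_sum => C _; rewrite sum1_card; apply/subset_leq_card/subsetP => x.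
by rewrite unfold_in inE => /andP[/andP[_ xL] /eqP<-]; rewrite inE mem_component_of.
Qed.

(** With odd girth g_C = 2 k_C - 1, twice the summand of n0 for a component C is
    at least 2 (number of nonleaves of C) - g_C - 1.  L stands for the total
    length of the cycles that are counted once. *)
Lemma n0_bound U N L : U != set0 ->
  (forall x, x \in U -> exists2 c, ucycle (induced e (component_of x)) c & odd (size c)) ->
  N + L <= \sum_(C in component_of @: U) #|C :&: nonleaf e| * 2 ->
  (if odd #|component_of @: U| then \sum_(C in component_of @: U) odd_girth e C <= L
   else \sum_(C in component_of @: U) odd_girth e C <=
        L + odd_girth e (cover (component_of @: U))) ->
  N + 1 <= n0 e (cover (component_of @: U)) * 2.
Proof.
move=> U0 cyc NL gL; set A := cover _ in gL *; set F := component_of @: U in NL gL *.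
have nbF : nonbip_components e A = F.
  rewrite /nonbip_components components_cover -/F; apply/setP=> C; rewrite inE.
  apply: andb_idr => /imsetP[x xU ->]; have [c /andP[cc _] oc] := cyc _ xU.
  by apply/negP=> /bipartite_no_odd_cycle/(_ cc); rewrite oc.
have gE C : C \in F -> odd (odd_girth e C).
  by move=> /imsetP[x xU ->]; have [c uc oc] := cyc _ xU; have [] := odd_girth_cycle uc oc.
have [x xU] := set0Pn _ U0.
have F0 : #|F| != 0 by rewrite cards_eq0; apply/set0Pn; exists (component_of x); apply: imset_f.
have gA : odd (odd_girth e A).
  have [c uc oc] := cyc _ xU; have uA : ucycle (induced e A) c.
    apply: (ucycle_sub uc) => y yc; have /andP[cc _] := uc.
    by apply/bigcupP; exists (component_of x); [exact: imset_f | exact: sub_cycle cc yc].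
  by have [] := odd_girth_cycle uA oc.
rewrite /n0 nbF (negPf F0).
set S := \sum_(C in F) (_ - _ - _).
have key : \sum_(C in F) #|C :&: nonleaf e| * 2 <= S * 2 + #|F| + \sum_(C in F) odd_girth e C.
  have pt C : C \in F -> #|C :&: nonleaf e| * 2 <=
      (#|C| - #|leaf_edges e C| - half_odd_girth e C) * 2 + 1 + odd_girth e C.
    move=> CF; have : #|C :&: nonleaf e| <= #|C| - #|leaf_edges e C|.
      by apply: nonleaf_le; have /imsetP[y _ ->] := CF; apply: component_of_closed.
    have := odd_uphalfK (gE _ CF); rewrite -/(half_odd_girth e C) -muln2.
    by clear; lia.
  apply: leq_trans (leq_sum _ pt) _.
  by rewrite !big_split -big_distrl sum1_card.
have hA := odd_uphalfK gA; rewrite -/(half_odd_girth e A) -muln2 in hA.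
have := odd_double_half #|F|; rewrite -muln2.
by case: (odd #|F|) gL => gL; clear -key hA gL NL; lia.
Qed.

(** R' is the set of all roots, or misses one of them for the sake of parity.
    When the number of components of G meeting U is odd and that of the roots is
    even, two roots lie in one component, and one of the two is dropped.  When
    both numbers are even, the dropped root lies in a component that contains a
    shortest odd cycle, whose length is compensated by the last term. *)
Lemma odd_selection U (c : T -> seq T) : U != set0 ->
  (forall x, x \in U -> [/\ ucycle (induced e U) (c x), odd (size (c x))
     & {in c x, forall y, connect (induced e U) x y}]) ->
  exists2 R' : {set T}, R' \subset component_roots e U /\ odd #|R'| &
  (if odd #|component_of @: U|
   then \sum_(C in component_of @: U) odd_girth e C <= \sum_(x in R') size (c x)
   else \sum_(C in component_of @: U) odd_girth e C <=
        \sum_(x in R') size (c x) + odd_girth e (cover (component_of @: U))).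
Proof.
move=> U0 cP; set R := component_roots e U; set F := component_of @: U; set A := cover F.
have RU x : x \in R -> x \in U by rewrite inE => /andP[].
have cne x : x \in U -> exists y, y \in c x.
  by move=> /cP[_ + _]; case: (c x) => [//|y s] _; exists y; rewrite mem_head.
have girth x : x \in U -> odd_girth e (component_of x) <= size (c x).
  move=> xU; have [uc oc con] := cP _ xU; apply: odd_girth_le => //.
  by apply: (ucycle_sub uc) => y /con /connect_induced_sub; rewrite inE.
have girthR (R' : {set T}) : R' \subset R ->
    \sum_(C in component_of @: R') odd_girth e C <= \sum_(x in R') size (c x).
  by move=> /subsetP R'R; apply: sum_girth_le => x /R'R /RU; apply: girth.
have compR : component_of @: R = F.
  apply/setP=> C; apply/imsetP/imsetP => [[x /RU xU ->]|[x xU ->]]; first by exists x.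
  have cx := connect_root (induced e U) x; exists (fingraph.root (induced e U) x).
    rewrite inE (connect_induced_mem cx xU) /= root_root //.
    exact: connect_induced_sym.
  by symmetry; apply: component_of_eq; rewrite inE (connect_induced_sub cx).
have [oR|eR] := boolP (odd #|R|).
  exists R; rewrite ?oR //; have := girthR _ (subxx R); rewrite compR => GL.
  by case: ifP => // _; apply: leq_trans GL (leq_addr _ _).
have dropR x : x \in R -> R :\ x \subset R /\ odd #|R :\ x|.
  move=> xR; split; first exact: subD1set.
  by move: eR; rewrite (cardsD1 x) xR /= negbK.
have [oF|eF] := boolP (odd #|F|).
  have [x [y [xR yR xy exy]]] : exists x y, [/\ x \in R, y \in R, x != y
      & component_of x = component_of y].
    apply: NNPP => none; move: eR.
    rewrite -(@card_in_imset _ _ component_of) ?compR ?oF //.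
    move=> x y xR yR exy.
    by apply/eqP; apply: contraT => xy; case: none; exists x, y.
  exists (R :\ x); first exact: dropR.
  rewrite -compR; suff -> : component_of @: R = component_of @: (R :\ x) by apply/girthR/subD1set.
  apply/eqP; rewrite eqEsubset (imsetS _ (subD1set _ _)) andbT.
  apply/subsetP=> _ /imsetP[z zR ->]; have [->|zx] := eqVneq z x.
    by rewrite exy imset_f // !inE eq_sym xy; move: yR; rewrite inE.
  by rewrite imset_f // in_setD1 zx.
have [x xU] := set0Pn _ U0.
have [C0 C0F gC0] : exists2 C0, C0 \in F & odd_girth e C0 <= odd_girth e A.
  have [uc oc con] := cP _ xU.
  have xA y : y \in U -> component_of y \subset A 
    by move=> yU; apply/subsetP=> z zy; apply/bigcupP; exists (component_of y); rewrite ?imset_f.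
  have uA : ucycle (induced e A) (c x).
    apply: (ucycle_sub uc) => y /con /connect_induced_sub xy.
    by apply: (subsetP (xA _ xU)); rewrite inE.
  have [oA [c' uc' sc']] := odd_girth_cycle uA oc.
  have [z zc'] : exists z, z \in c'.
    by case: c' sc' {uc'} => [s0|z s _]; [rewrite -s0 in oA|exists z; rewrite mem_head].
  have zA : z \in A by have /andP[cc _] := uc'; apply: sub_cycle cc zc'.
  have /bigcupP[C CF zC] := zA; exists C => //; have /imsetP[u uU CE] := CF.
  rewrite -sc'; apply: odd_girth_le; last by rewrite sc'.
  by rewrite CE -(component_of_eq (x := u) (y := z)) -?CE //; apply: ucycle_in_component uc' zc'.
have [x0 x0R C0E] : exists2 x0, x0 \in R & C0 = component_of x0.
  by move: C0F; rewrite -compR => /imsetP[x0 ? ->]; exists x0.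
exists (R :\ x0); first exact: dropR.
rewrite (bigD1 C0) //= addnC leq_add //.
apply: leq_trans (girthR _ (subD1set _ _)).
rewrite [X in _ <= X](bigID (mem F)) /=; apply: leq_trans (leq_addr _ _).
rewrite big_mkcond [X in _ <= X]big_mkcond; apply: leq_sum => C _.
case: ifP => // /andP[CF CC0]; have := CF; rewrite -compR => /imsetP[z zR CE].
have zR' : z \in R :\ x0.
  by rewrite in_setD1 zR andbT; apply: contra CC0 => /eqP zx; rewrite CE C0E zx.
by rewrite CE !imset_f.
Qed.

(** The total of b has the parity of the sum of the odd lengths over R', hence is
    odd. *)
Lemma expanding_phi0 U a : U != set0 -> expanding e U a ->
  exists2 b, expanding e U b &
    exists2 k, k <= phi0 e & \sum_(x in U) b x + 1 = k * 2.
Proof.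
move=> U0 exa.
have cycle_at x : exists cx : seq T, x \in U -> [/\ ucycle (induced e U) cx,
    odd (size cx) & {in cx, forall y, connect (induced e U) x y}].
  have [xU|xU] := boolP (x \in U); last by exists [::].
  by have [c] := expanding_odd_cycle e_sym exa xU; exists c.
have [c cP] := fin_all_exists cycle_at.
have [R' [R'R oR'] gL] := odd_selection U0 cP.
have [b exb [m mL sb]] := expanding_from_cycles e_sym e_irr cP R'R.
exists b => //; have := odd_sum_odd (P := R') (F := fun x => size (c x)).
rewrite oR' => oL; have {}oL := oL _.
have ob : odd (\sum_(x in U) b x).
  have : odd (\sum_(x in U) b x + \sum_(x in R') size (c x)) = false by rewrite sb; lia.
  rewrite oddD oL; first by case: (odd _).
  by move=> x /(subsetP R'R); rewrite inE => /andP[/cP[]].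
exists (\sum_(x in U) b x + 1)./2; last by lia.
have cyc x : x \in U -> exists2 c', ucycle (induced e (component_of x)) c' & odd (size c').
  move=> xU; have [uc oc con] := cP _ xU; exists (c x) => //.
  by apply: (ucycle_sub uc) => y /con /connect_induced_sub; rewrite inE.
have /(n0_bound U0 cyc)/(_ gL) : \sum_(x in U) b x + \sum_(x in R') size (c x)
    <= \sum_(C in component_of @: U) #|C :&: nonleaf e| * 2.
  rewrite sb -big_distrl leq_mul2r /=; exact: leq_trans mL (card_nonleaf_le U).
have : n0 e (cover (component_of @: U)) <= phi0 e.
  apply: (leq_bigmax_cond (F := fun F => n0 e (cover F))).
  by apply/subsetP=> _ /imsetP[x _ ->]; apply: component_of_components.
lia.
Qed.

Lemma phi0_gt0 : 0 < phi0 e.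
Proof.
apply: leq_trans (leq_bigmax_cond (F := fun F => n0 e (cover F)) _ (sub0set _)).
rewrite /n0; suff -> : nonbip_components e (cover set0) = set0 by rewrite cards0.
rewrite /cover big_set0; apply/setP=> C; rewrite !inE; apply/negP=> /andP[/imsetP[x]].
by rewrite inE.
Qed.

End Girth.

(** * The stability index *)

(** The right-hand side does not involve n. *)
Lemma assoc_at_stable (T : finType) (e : rel T) n (F : {set T}) :
    symmetric e -> irreflexive e -> phi0 e <= n ->
  assoc_at e n F <->
  (forall x y, e x y -> (x \in F) || (y \in F)) /\
  (core e F != set0 -> exists a, expanding e (core e F) a).
Proof.
move=> e_sym e_irr phin; split=> [aF|[cF exF]].
  split=> [x y exy|_]; last exact: (core_expanding e_sym aF).
  have [w [/half_coverP/(_ x y exy) wxy wF] _] := aF.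
  by rewrite !wF -addn_gt0; apply: leq_trans wxy.
apply: expanding_assoc => // [|U0].
  exact: leq_trans (phi0_gt0 e) phin.
have [a exa] := exF U0; have [b exb [k kphi sb]] := expanding_phi0 e_sym e_irr U0 exa.
by exists b => //; exists k => //; apply: leq_trans phin.
Qed.

Lemma least_nat (P : nat -> Prop) n : P n ->
  exists2 m, P m /\ (forall k, P k -> m <= k) & m <= n.
Proof.
elim/ltn_ind: n => n IH Pn.
have [[k [kn Pk]]|none] := classic (exists k, k < n /\ P k).
  by have [m mP mk] := IH k kn Pk; exists m => //; apply: leq_trans mk (ltnW kn).
exists n => //; split=> // k Pk; rewrite leqNgt; apply/negP=> kn.
by apply: none; exists k.
Qed.

Theorem theorem3p8 (K : fieldType) (r : nat) (e : rel 'I_r)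
    (e_sym : symmetric e) (e_irr : irreflexive e) :
  exists2 a : nat, is_astab_bar (edge_ideal K e) a & (a <= phi0 e)%N.
Proof.
have stable : Ass_bar_stable_from (edge_ideal K e) (phi0 e).
  have step n n' P : phi0 e <= n -> phi0 e <= n' ->
      Ass (integral_closure (ideal_pow (edge_ideal K e) n)) P ->
      Ass (integral_closure (ideal_pow (edge_ideal K e) n')) P.
    move=> phin phin' /(Ass_edge_pow e_sym)[F aF PF]; apply/(Ass_edge_pow e_sym).
    exists F => //; apply/(assoc_at_stable F e_sym e_irr phin').
    exact/(assoc_at_stable F e_sym e_irr phin).
  by move=> n phin P; split; apply: step.
have [a [[a0 sa] amin] ale] :=
  @least_nat (fun n => 0 < n /\ Ass_bar_stable_from (edge_ideal K e) n) _
    (conj (phi0_gt0 e) stable).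
by exists a => //; split=> // n n0 sn; apply: amin.
Qed.
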